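(* Consider the heterogeneous bump regression (HBR) model with $|I_n|\searrow 0$, and let $(\varepsilon_n)$ be any sequence such that $\varepsilon_n\to 0$ and $\varepsilon_n\sqrt{-\log(|I_n|)}\to\infty$ as $n\to\infty$. 1. Let $\sigma_n^2=c\,\sigma_0\Delta_n(1+o(\varepsilon_n))$ with a constant $c>0$, and $\sigma_n^2=o(\varepsilon_n)$ as $n\to\infty$. If $$\sqrt{n|I_n|}\,\Delta_n\precsim (C-\varepsilon_n)\sqrt{-\log(|I_n|)},\qquad C:=\sqrt2\,\sigma_0\sqrt{\frac{2}{2+c^2}},$$ as $n\to\infty$, then the corresponding sequence of bump alternatives is undetectable. 2. Let $\sigma_n^2=\sigma^2(1+o(\varepsilon_n))$ and $\Delta_n=\frac{\sigma^2}{c\,\sigma_0}(1+o(\varepsilon_n))$ as $n\to\infty$ with constants $\sigma>0$, $c>0$, and put $\kappa:=\sigma/\sigma_0$. If $$\sqrt{n|I_n|}\precsim (C-\varepsilon_n)\sqrt{-\log(|I_n|)},\qquad C:=\frac{1}{\sqrt{\frac{\kappa^2}{2c^2}(\kappa^2+c^2)-\frac12\log(1+\kappa^2)}},$$ as $n\to\infty$, then the corresponding sequence of bump alternatives is undetectable.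
   Context: HBR model: for each $n$ one observes $Y=(Y_1,\dots,Y_n)$ with $Y_i=\mu_n(i/n)+\lambda_n(i/n)Z_i$, where $Z_1,\dots,Z_n$ are i.i.d. $\mathcal N(0,1)$. The parameters $\sigma_0>0$ (fixed), $\Delta_n>0$, $\sigma_n>0$ and $|I_n|\in(0,1]$ are known; put $\kappa_n=\sigma_n/\sigma_0$. It is assumed that $l_n:=1/|I_n|\in\mathbb N$ and $n|I_n|\in\mathbb N$, and $\mathcal A_n:=\{((j-1)|I_n|,\,j|I_n|] : 1\le j\le l_n\}$, so that each interval in $\mathcal A_n$ contains exactly $n|I_n|$ of the points $i/n$. The null hypothesis is $H_0:\ \mu_n\equiv 0,\ \lambda_n\equiv\sigma_0$; the alternative is $H_1^n:$ there is $I_n\in\mathcal A_n$ with $\mu_n=\Delta_n 1_{I_n}$ and $\lambda_n^2=\sigma_0^2+\sigma_n^2 1_{I_n}$ (the position of $I_n$ is unknown). A test is a measurable map $\Phi_n:\mathbb R^n\to\{0,1\}$ (1 means reject $H_0$). Type I error: $\bar\alpha(\Phi_n)=\mathbb P_{H_0}(\Phi_n(Y)=1)$. Type II error: $\bar\beta(\Phi_n)=\sup_{I_n\in\mathcal A_n}\mathbb P_{\mu_n=\Delta_n1_{I_n},\,\lambda_n^2=\sigma_0^2+\sigma_n^21_{I_n}}(\Phi_n(Y)=0)$. The sequence of alternatives given by $(\Delta_n,\sigma_n,|I_n|)_{n}$ is called undetectable if for every $\alpha\in(0,1)$ and every sequence of tests $\Phi_n$ with $\bar\alpha(\Phi_n)\le\alpha+o(1)$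 one has $1-\bar\beta(\Phi_n)-\alpha\le o(1)$ as $n\to\infty$ (i.e. $\limsup_n(1-\bar\beta(\Phi_n))\le\alpha$). Notation: $a_n\precsim b_n$ means there is $N\in\mathbb N$ such that $a_n\le b_n$ for all $n\ge N$. *)

(* Defs.v *)
From HB Require Import structures.
From mathcomp Require Import all_boot all_order all_algebra.
From mathcomp Require Import all_classical all_reals all_analysis.

Set Implicit Arguments.
Unset Strict Implicit.
Unset Printing Implicit Defensive.

Import Order.TTheory GRing.Theory Num.Theory.
Import numFieldNormedType.Exports.

Local Open Scope classical_set_scope.
Local Open Scope ring_scope.

Definition mutually_independent (R : realType) (d : measure_display)
    (T : measurableType d) (P : probability T R) (n : nat)
    (Z : 'I_n -> {RV P >-> R}) : Prop :=
  forall (J : {set 'I_n}) (B : 'I_n -> set R),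
    (forall i, measurable (B i)) ->
    P (\bigcap_(i in [set` J]) (Z i @^-1` B i)) =
    (\prod_(i in J) P (Z i @^-1` B i))%E.

Definition iid_std_normal (R : realType) (d : measure_display)
    (T : measurableType d) (P : probability T R) (n : nat)
    (Z : 'I_n -> {RV P >-> R}) : Prop :=
  mutually_independent Z /\
  forall i (B : set R), measurable B ->
    distribution P (Z i) B = normal_prob 0 1 B.

(* The index [i : 'I_n] runs over 0, ..., n - 1 and stands for the observation
   of rank [i.+1], at the design point [i.+1 / n]. *)
Definition hbr_obs (R : realType) (d : measure_display)
    (T : measurableType d) (P : probability T R) (n : nat)
    (Z : 'I_n -> {RV P >-> R}) (mu lambda : R -> R) (w : T) : n.-tuple R :=
  [tuple mu (i.+1%:R / n%:R) + lambda (i.+1%:R / n%:R) * Z i w | i < n].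

(* [h] is the common length of the candidate intervals; for [h > 0] the
   condition [j%:R <= h^-1] says that [j] is at most the number [1 / h] of
   intervals. *)
Definition candidate_intervals (R : realType) (h : R) : set (set R) :=
  [set [set x | j.-1%:R * h < x <= j%:R * h]
    | j in [set j : nat | (1 <= j)%N /\ j%:R <= h^-1]].

Definition bump_mean (R : realType) (Delta : R) (I : set R) (x : R) : R :=
  Delta * \1_I x.

Definition bump_sd (R : realType) (s0 s : R) (I : set R) (x : R) : R :=
  Num.sqrt (s0 ^+ 2 + s ^+ 2 * \1_I x).

(* A test is a measurable boolean function on [n.-tuple R] with the product
   sigma-algebra; [true] means that the null hypothesis is rejected. *)
Definition type1_error (R : realType) (d : measure_display)
    (T : measurableType d) (P : probability T R) (n : nat)
    (Z : 'I_n -> {RV P >-> R}) (s0 : R)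
    (Phi : {mfun n.-tuple R >-> bool}) : \bar R :=
  P [set w | Phi (hbr_obs Z (cst 0) (cst s0) w) = true].

Definition type2_error (R : realType) (d : measure_display)
    (T : measurableType d) (P : probability T R) (n : nat)
    (Z : 'I_n -> {RV P >-> R}) (s0 Delta s h : R)
    (Phi : {mfun n.-tuple R >-> bool}) : \bar R :=
  ereal_sup
    [set P [set w | Phi (hbr_obs Z (bump_mean Delta I) (bump_sd s0 s I) w)
                    = false]
      | I in candidate_intervals h].

Definition undetectable (R : realType) (d : nat -> measure_display)
    (T : forall n, measurableType (d n)) (P : forall n, probability (T n) R)
    (Z : forall n, 'I_n -> {RV (P n) >-> R})
    (s0 : R) (Delta s h : R^nat) : Prop :=
  forall (alpha : R) (Phi : forall n, {mfun n.-tuple R >-> bool}),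
    0 < alpha < 1 ->
    (limn_esup (fun n => type1_error (Z n) s0 (Phi n)) <= alpha%:E)%E ->
    (limn_esup (fun n =>
       1 - type2_error (Z n) s0 (Delta n) (s n) (h n) (Phi n)) <= alpha%:E)%E.

(* [a n = b n * (1 + o(eps n))] *)
Definition eq_up_to_littleo (R : realType) (a b eps : R^nat) : Prop :=
  exists2 r : R^nat, r =o_\oo eps &
    \forall n \near \oo, a n = b n * (1 + r n).

(* Main.v *)
Require Import Defs.
From HB Require Import structures.
From mathcomp Require Import all_boot all_order all_algebra.
From mathcomp Require Import all_classical all_reals all_analysis.
From mathcomp Require Import measurable_realfun ring lra.

Set Implicit Arguments.
Unset Strict Implicit.
Unset Printing Implicit Defensive.

Import Order.TTheory GRing.Theory Num.Theory.
Import numFieldNormedType.Exports.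

Local Open Scope classical_set_scope.
Local Open Scope ring_scope.

(** The position of the bump is unknown, so the worst-case power of a test is at
    most its power averaged over the [l = 1 / h] candidate blocks, and this
    average is the integral over the rejection event, under the null
    hypothesis, of the mean of [l] likelihood ratios.  These ratios are
    independent with expectation 1; as soon as their mean is close to 1 in L^1,
    the power exceeds the level by o(1) only.

    At the detection boundary the second moment of a likelihood ratio is too
    large, or infinite, for Chebyshev's inequality.  The ratios are therefore
    truncated at [l].  If [rho] denotes [l `^ (- dl)] times the moment of order
    [1 + dl] of a ratio, then the mass cut off by the truncation and the
    variance of the truncated mean are both at most [rho], which gives
    [1 - beta <= alpha + rho + sqrt rho]
    ([sum_likelihood_ratio_le], [power_le_type1_error]).

    For Gaussian laws the moment of order [1 + dl] is explicit
    ([normal_lr_moment]), and its logarithm per observation is [dl] times the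
    Kullback-Leibler divergence [kl] between bump and null, up to O(dl^2)
    ([log_moment_le]).  With [q = n * h] observations per block,
    [ln rho <= - dl * (ln l - q * kl) + O(dl^2 * ln l)].  In both regimes [C]
    is the constant for which the signal bound with [eps = 0] reads
    [q * kl <= ln l] to first order, and the loss [eps] in that bound leaves
    [q * kl <= (1 - c1 * eps) * ln l] for some [c1 > 0]
    ([small_variance_rate], [fixed_variance_rate]); the errors o(eps) in the
    parameters are absorbed in [c1].  Taking [dl] proportional to [eps] gives
    [ln rho <= - k * (eps * sqrt (ln l))^2] with [k > 0], which tends to -oo by
    the assumption on [eps] ([undetectable_of_rate]).

    The change of measure takes place on tuples of observations: a finite
    measure on tuples is determined by its values on boxes
    ([measure_tuple_unique]), and on boxes independence reduces the claim to
    one coordinate, where it is an affine substitution in a Gaussian integral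
    ([normal_lr_change_of_measure]). *)

(** * Measures on tuples *)

Section tuple_boxes.
Context d (T : measurableType d) (n : nat).

Definition tuple_box (B : 'I_n -> set T) : set (n.-tuple T) :=
  [set t | forall i, B i (tnth t i)].

Lemma tuple_boxE B : tuple_box B = \bigcap_i ((fun t => tnth t i) @^-1` B i).
Proof. by apply/seteqP; split => t /= h i; [move=> _|]; exact: h. Qed.

Lemma measurable_tuple_box B :
  (forall i, measurable (B i)) -> measurable (tuple_box B).
Proof.
move=> mB; rewrite tuple_boxE; apply: fin_bigcap_measurable => // i _.
by rewrite -[_ @^-1` _]setTI; apply: measurable_tnth.
Qed.

Lemma measurable_tuple_boxesE : @measurable _ (n.-tuple T) =
  <<s [set tuple_box B | B in [set B | forall i, measurable (B i)]] >>.
Proof.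
apply/seteqP; split; last first.
  apply: smallest_sub; first exact: sigma_algebra_measurable.
  by move=> _ [B mB <-]; exact: measurable_tuple_box.
apply: smallest_sub; first exact: smallest_sigma_algebra.
rewrite -bigcup_seq => A [i _ [B mB <-]]; apply: sub_sigma_algebra.
exists (fun j => if j == i then B else setT).
  by move=> j /=; case: ifP.
rewrite setTI; apply/seteqP; split => t /= h.
  by have := h i; rewrite eqxx.
by move=> j; case: eqP => // ->.
Qed.

(** Boxes are stable under intersection and generate the product sigma-algebra,
    so Dynkin's uniqueness theorem applies. *)
Lemma measure_tuple_unique (R : realType)
    (m1 m2 : {measure set (n.-tuple T) -> \bar R}) :
  (m1 setT < +oo)%E ->
  (forall B, (forall i, measurable (B i)) ->
    m1 (tuple_box B) = m2 (tuple_box B)) ->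
  forall A, measurable A -> m1 A = m2 A.
Proof.
move=> fin m12; apply: (measure_unique
    [set tuple_box B | B in [set B | forall i, measurable (B i)]] (fun=> setT)).
- exact: measurable_tuple_boxesE.
- move=> _ _ [A mA <-] [B mB <-]; exists (fun i => A i `&` B i).
    by move=> i; exact: measurableI.
  apply/seteqP; split => t /=; first by move=> h; split => i; have [] := h i.
  by move=> [h1 h2] i; split.
- move=> _; exists (fun=> setT) => //; exact/seteqP.
- by rewrite bigcup_const//; exists 0%N.
- by move=> _ [B mB <-]; exact: m12.
- by move=> _.
Qed.

End tuple_boxes.

(** * Measures with a density *)

Section density.
Local Open Scope ereal_scope.
Context d (T : measurableType d) (R : realType).
Variables (mu : {measure set T -> \bar R}) (g : T -> R).
Hypotheses (mg : measurable_fun setT g) (g0 : forall x, (0 <= g x)%R).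

(** The proofs are arguments so that the measure structure can be found from the
    term alone. *)
Definition with_density (mg : measurable_fun setT g)
  (g0 : forall x, (0 <= g x)%R) (A : set T) := \int[mu]_(x in A) (g x)%:E.

Local Notation nu := (with_density mg g0).

Let nu0 : nu set0 = 0. Proof. exact: integral_set0. Qed.

Let nu_ge0 A : 0 <= nu A.
Proof. by apply: integral_ge0 => x _; rewrite lee_fin. Qed.

Let nu_sigma_additive : semi_sigma_additive nu.
Proof.
move=> F mF tF mUF; rewrite /with_density ge0_integral_bigcup//.
- apply: is_cvg_ereal_nneg_natsum_cond => n _ _.
  by apply: integral_ge0 => x _; rewrite lee_fin.
- by apply/measurable_EFinP; exact: measurable_funTS.
- by move=> x _; rewrite lee_fin.
Qed.

HB.instance Definition _ := isMeasure.Build _ _ _ nu nu0 nu_ge0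
  nu_sigma_additive.

Import HBNNSimple.

Lemma ge0_integral_with_density (f : T -> \bar R) :
  measurable_fun setT f -> (forall x, 0 <= f x) ->
  \int[nu]_x f x = \int[mu]_x (f x * (g x)%:E).
Proof.
move=> mf f0.
pose f_ := nnsfun_approx measurableT mf.
have mG : measurable_fun setT (fun x => (g x)%:E) by exact/measurable_EFinP.
transitivity (limn (fun n => \int[nu]_x (f_ n x)%:E)).
  rewrite -monotone_convergence//=.
  - by apply: eq_integral => x _; apply/esym/cvg_lim => //; exact: cvg_nnsfun_approx.
  - by move=> n; exact/measurable_EFinP.
  - by move=> n x _; rewrite lee_fin.
  - by move=> x _ a b ab; rewrite lee_fin; exact/lefP/nd_nnsfun_approx.
transitivity (limn (fun n => \int[mu]_x ((f_ n x)%:E * (g x)%:E))); last first.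
  rewrite -monotone_convergence//=.
  - apply: eq_integral => x _; apply/cvg_lim => //.
    by apply: cvgeZr => //; exact: cvg_nnsfun_approx.
  - by move=> n; apply: emeasurable_funM => //; exact/measurable_EFinP.
  - by move=> n x _; rewrite mule_ge0// lee_fin.
  - move=> x _ a b ab; rewrite lee_wpmul2r// lee_fin//.
    exact/lefP/nd_nnsfun_approx.
congr (limn _); apply/funext => n.
have indich r : measurable_fun setT (fun x => (r * \1_(f_ n @^-1` [set r]) x)%:E).
  by apply: (measurable_comp measurableT) => //; exact: measurable_funM.
transitivity (\int[nu]_x
   (\sum_(y \in range (f_ n)) (y * \1_(f_ n @^-1` [set y]) x)%:E)).
  by apply: eq_integral => t tE; rewrite /= fimfunE -fsumEFin.
rewrite ge0_integral_fsum//; last by move=> m y Ey; exact: nnfun_muleindic_ge0.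
transitivity (\int[mu]_x (\sum_(y \in range (f_ n))
    (y * \1_(f_ n @^-1` [set y]) x)%:E * (g x)%:E)); last first.
  under [RHS]eq_integral => x xE.
    rewrite fimfunE -fsumEFin// ge0_mule_fsuml => [|y]; last exact: nnfun_muleindic_ge0.
    over.
  by [].
rewrite ge0_integral_fsum//; last 2 first.
  - by move=> y; apply: emeasurable_funM.
  - by move=> m y Ey; apply: mule_ge0; [exact: nnfun_muleindic_ge0|rewrite lee_fin].
apply: eq_fsbigr => r rhn.
under [LHS]eq_integral do rewrite EFinM.
rewrite integralZl_indic_nnsfun => //.
under [RHS]eq_integral do rewrite EFinM -muleA.
rewrite ge0_integralZl//.
- under [in RHS]eq_integral do rewrite muleC.
  rewrite [in RHS](eq_integral ((fun x => (g x)%:E) \_ (f_ n @^-1` [set r]))); last first.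
    by move=> x xE; rewrite epatch_indic.
  by rewrite -integral_mkcondr integral_indic// setIT setTI.
- by apply: emeasurable_funM => //; exact/measurable_EFinP.
- by move=> t Et; rewrite mule_ge0 ?lee_fin.
- by move: rhn; rewrite inE => -[t _ <-]; rewrite lee_fin.
Qed.

End density.

(** * Independence *)

Lemma measurable_prod_cond d (T : measurableType d) (R : realType)
    (I : finType) (Q : pred I) (h : I -> T -> R) :
  (forall i, measurable_fun setT (h i)) ->
  measurable_fun setT (fun x => \prod_(i | Q i) h i x).
Proof.
move=> mh; under eq_fun do rewrite big_mkcond.
by apply: measurable_prod => i _; case: (Q i).
Qed.

Section independent_pair.
Local Open Scope ereal_scope.
Context d d1 d2 (T : measurableType d) (E1 : measurableType d1)
  (E2 : measurableType d2) (R : realType) (P : probability T R).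

Definition independent_pair (U : T -> E1) (V : T -> E2) :=
  forall A B, measurable A -> measurable B ->
    P (U @^-1` A `&` V @^-1` B) = P (U @^-1` A) * P (V @^-1` B).

(** The joint law is the product of the marginal laws, so that Tonelli's theorem
    applies. *)
Lemma independent_ge0_integralM (U : T -> E1) (V : T -> E2)
    (f : E1 -> \bar R) (g : E2 -> \bar R) :
  measurable_fun setT U -> measurable_fun setT V -> independent_pair U V ->
  measurable_fun setT f -> measurable_fun setT g ->
  (forall x, 0 <= f x) -> (forall y, 0 <= g y) ->
  \int[P]_w (f (U w) * g (V w)) = \int[P]_w f (U w) * \int[P]_w g (V w).
Proof.
move=> mU mV UV mf mg f0 g0.
pose Um := isMeasurableFun.Build _ _ _ _ _ mU.
pose U' : {mfun _ >-> _} := HB.pack U Um.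
pose Vm := isMeasurableFun.Build _ _ _ _ _ mV.
pose V' : {mfun _ >-> _} := HB.pack V Vm.
have mUV : measurable_fun setT (fun w => (U w, V w)).
  exact: measurable_fun_pair.
pose Wm := isMeasurableFun.Build _ _ _ _ _ mUV.
pose W : {mfun T >-> (E1 * E2)%type} := HB.pack (fun w => (U w, V w)) Wm.
pose h (z : E1 * E2) := f z.1 * g z.2.
have mh : measurable_fun setT h.
  by apply: emeasurable_funM; exact: measurableT_comp.
have h0 z : 0 <= h z by exact: mule_ge0.
have <- : \int[distribution P W]_z h z = \int[P]_w (f (U w) * g (V w)).
  by rewrite ge0_integral_distribution.
have <- : \int[(distribution P U' \x distribution P V')%E]_z h z =
    \int[distribution P W]_z h z.
  apply: eq_measure_integral => A mA _.
  exact: product_measure_unique.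
rewrite fubini_tonelli1//.
have <- : \int[distribution P U']_x f x = \int[P]_w f (U w).
  by rewrite ge0_integral_distribution.
have <- : \int[distribution P V']_x g x = \int[P]_w g (V w).
  by rewrite ge0_integral_distribution.
rewrite -ge0_integralZr//; last exact: integral_ge0.
apply: eq_integral => x _; rewrite /fubini_F.
by rewrite -(ge0_integralZl _ measurableT mg).
Qed.

End independent_pair.

Section mutual_independence.
Context (R : realType) (d : measure_display) (T : measurableType d)
  (P : probability T R) (n : nat) (Z : 'I_n -> {RV P >-> R}).
Hypothesis indepZ : mutually_independent Z.

Lemma mutually_independent_all (B : 'I_n -> set R) :
  (forall i, measurable (B i)) ->
  P [set w | forall i, B i (Z i w)] = (\prod_i P (Z i @^-1` B i))%E.
Proof.
move=> mB; have := indepZ [set: 'I_n]%SET mB.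
under eq_bigl do rewrite finset.in_setT.
move=> <-; congr (P _); apply/seteqP; split => w /= h i //=.
by apply: h => /=; rewrite finset.in_setT.
Qed.

(** The coordinates outside [J] are replaced by 0, so that all sub-families
    take values in the same space of tuples. *)
Definition subfamily (J : {set 'I_n}) (w : T) : n.-tuple R :=
  [tuple if i \in J then Z i w else 0 | i < n].

Lemma measurable_subfamily J : measurable_fun setT (subfamily J).
Proof.
apply/measurable_fun_tnthP => i.
rewrite (_ : _ \o _ = if i \in J then Z i : T -> R else cst 0).
  by case: ifP.
by apply/funext => w /=; rewrite tnth_mktuple; case: ifP.
Qed.

Let constant_event (U : Type) (X : Prop) :
  [set y : U | X] = setT \/ [set y : U | X] = set0.
Proof.
have [x|nx] := pselect X; [left|right]; apply/seteqP; split => // y; exact: nx.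
Qed.

(* The condition that [B i] puts on the variable of index [i] through
   [subfamily J]: it is constant when [i] lies outside [J]. *)
Let masked (J : {set 'I_n}) (B : 'I_n -> set R) (i : 'I_n) : set R :=
  [set x | B i (if i \in J then x else 0)].

Let measurable_masked J B i : measurable (B i) -> measurable (masked J B i).
Proof.
rewrite /masked; case: (i \in J) => // mB.
by have [->|->] := constant_event R (B i 0).
Qed.

Let subfamily_box J B :
  subfamily J @^-1` tuple_box B = [set w | forall i, masked J B i (Z i w)].
Proof.
by apply/seteqP; split => w /= h i; have := h i; rewrite tnth_mktuple.
Qed.

(* At each index one of the two conditions is constant, so that the product over
   all indices splits factor by factor. *)
Let independent_boxes (J K : {set 'I_n}) B C : {in J, forall i, i \notin K} ->
  (forall i, measurable (B i)) -> (forall i, measurable (C i)) ->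
  P (subfamily J @^-1` tuple_box B `&` subfamily K @^-1` tuple_box C) =
  (P (subfamily J @^-1` tuple_box B) * P (subfamily K @^-1` tuple_box C))%E.
Proof.
move=> JK mB mC; rewrite !subfamily_box.
rewrite (_ : _ `&` _ = [set w | forall i,
  (masked J B i `&` masked K C i) (Z i w)]); last first.
  apply/seteqP; split => w /= => [[h1 h2] i|h]; first by split.
  by split => i; have [] := h i.
have mmB i : measurable (masked J B i) by exact: measurable_masked.
have mmC i : measurable (masked K C i) by exact: measurable_masked.
rewrite (mutually_independent_all mmB) (mutually_independent_all mmC).
rewrite (mutually_independent_all (fun i => measurableI _ _ (mmB i) (mmC i))).
rewrite -big_split/=; apply: eq_bigr => i _; rewrite preimage_setI /masked.
case: (boolP (i \in J)) => iJ.
  rewrite (negbTE (JK _ iJ)); have [->|->] := constant_event R (C i 0).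
    by rewrite preimage_setT setIT probability_setT mule1.
  by rewrite preimage_set0 setI0 measure0 mule0.
have [->|->] := constant_event R (B i 0).
  by rewrite preimage_setT setTI probability_setT mul1e.
by rewrite preimage_set0 set0I measure0 mul0e.
Qed.

(* Both sides are finite measures in [A], hence it is enough to compare them on
   boxes. *)
Let independent_extend (J : {set 'I_n}) (D : set T) : measurable D ->
  (forall B, (forall i, measurable (B i)) ->
    P (subfamily J @^-1` tuple_box B `&` D) =
    (P (subfamily J @^-1` tuple_box B) * P D)%E) ->
  forall A, measurable A ->
    P (subfamily J @^-1` A `&` D) = (P (subfamily J @^-1` A) * P D)%E.
Proof.
move=> mD h.
have mU := measurable_subfamily J.
pose m1 : {measure set _ -> \bar R} :=
  pushforward (mrestr P mD) (subfamily J).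
have Pf : P D = (fine (P D))%:E by rewrite fineK// fin_num_measure.
have c0 : 0 <= fine (P D) by rewrite fine_ge0.
pose m2 : {measure set _ -> \bar R} :=
  mscale (NngNum c0) (pushforward P (subfamily J)).
move=> A mA; rewrite muleC [X in (X * _)%E]Pf.
change (m1 mU A = m2 mU A).
apply: measure_tuple_unique => //.
- rewrite /m1 /= /pushforward /mrestr preimage_setT setTI.
  by rewrite -ge0_fin_numE// fin_num_measure.
- move=> B mB; rewrite /m1 /m2 /= /pushforward /mrestr /mscale /= -Pf muleC.
  exact: h.
Qed.

(** The product rule is extended from boxes to all measurable sets, one family at
    a time. *)
Lemma independent_subfamilies (J K : {set 'I_n}) : {in J, forall i, i \notin K} ->
  independent_pair P (subfamily J) (subfamily K).
Proof.
move=> JK A B mA mB.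
have msub L C : measurable C -> measurable (subfamily L @^-1` C).
  by move=> mC; rewrite -[_ @^-1` _]setTI; exact: measurable_subfamily.
apply: independent_extend => //; first exact: msub.
move=> C mC; rewrite setIC muleC; apply: independent_extend => //.
  by apply: msub; exact: measurable_tuple_box.
move=> D mDi; apply: independent_boxes => // i iK.
by apply/negP => /JK; rewrite iK.
Qed.

(** One index is split off at a time: its variable is independent of the rest of
    the family. *)
Lemma mutually_independent_ge0_integral_prod (f : 'I_n -> R -> R) :
  (forall i, measurable_fun setT (f i)) -> (forall i x, 0 <= f i x) ->
  forall J : {set 'I_n},
  (\int[P]_w (\prod_(i in J) f i (Z i w))%:E =
   \prod_(i in J) \int[P]_w (f i (Z i w))%:E)%E.
Proof.
move=> mf f0 J; have [k] := ubnP #|J|.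
elim: k J => // k IH J Jk.
have [->|/set0Pn[i iJ]] := eqVneq J finset.set0.
  rewrite big_set0; under eq_integral do rewrite big_set0.
  by rewrite integral_cst//= mul1e; exact: probability_setT.
rewrite (big_setD1 i iJ)/= -IH; last first.
  by move: Jk; rewrite (cardsD1 i) iJ.
have mtnth j : measurable_fun setT (fun t : n.-tuple R => f j (tnth t j)).
  by apply: measurableT_comp => //; exact: measurable_tnth.
pose F (t : n.-tuple R) := (f i (tnth t i))%:E.
pose G (t : n.-tuple R) := (\prod_(j in (J :\ i)%SET) f j (tnth t j))%:E.
transitivity (\int[P]_w (F (subfamily [set i]%SET w) *
                         G (subfamily (J :\ i)%SET w)))%E.
  apply: eq_integral => w _; rewrite /F /G (big_setD1 i iJ)/= EFinM.
  congr (_%:E * _%:E)%E; first by rewrite tnth_mktuple inE eqxx.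
  by apply: eq_bigr => j jJ; rewrite tnth_mktuple jJ.
rewrite independent_ge0_integralM.
- congr (_ * _)%E; apply: eq_integral => w _; rewrite /F /G.
    by rewrite tnth_mktuple inE eqxx.
  by congr EFin; apply: eq_bigr => j jJ; rewrite tnth_mktuple jJ.
- exact: measurable_subfamily.
- exact: measurable_subfamily.
- apply: independent_subfamilies => j; rewrite !inE => /eqP ->.
  by rewrite eqxx.
- exact/measurable_EFinP.
- by apply/measurable_EFinP; exact: measurable_prod_cond.
- by move=> t; rewrite lee_fin.
- by move=> t; rewrite lee_fin prodr_ge0.
Qed.

End mutual_independence.

(** * Gaussian likelihood ratios *)

Section affine_lebesgue.
Context (R : realType).
Local Notation mu := (@lebesgue_measure R).
Variables a b : R.
Hypothesis b0 : 0 < b.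

Let affine (x : measurableTypeR R) : measurableTypeR R := a + b * x.

Let measurable_affine : measurable_fun setT affine.
Proof. by apply: measurable_funD => //; exact: measurable_funM. Qed.

Let affine_itv (x y : R) : affine @^-1` `]x, y]%classic =
  `](x - a) / b, (y - a) / b]%classic.
Proof.
apply/seteqP; split => z /=; rewrite !in_itv/= /affine => /andP[h1 h2].
  by rewrite ltr_pdivrMr// ler_pdivlMr// mulrC ltrBlDl lerBrDl h1.
move: h1 h2; rewrite ltr_pdivrMr// ler_pdivlMr// mulrC ltrBlDl lerBrDl.
by move=> -> ->.
Qed.

Let affine_lebesgue (A : set (measurableTypeR R)) : measurable A ->
  (b%:E * mu (affine @^-1` A))%E = mu A.
Proof.
move=> mA.
pose m : {measure set _ -> \bar R} :=
  mscale (NngNum (ltW b0)) (pushforward mu affine).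
change (m measurable_affine A = mu A).
apply/esym/lebesgue_measure_unique => //= _ [[x y]] _ <-.
rewrite /m /mscale /= /pushforward affine_itv !lebesgue_measure_itv/= !lte_fin.
rewrite ltr_pM2r ?invr_gt0// ltrD2r; case: ifP; last by rewrite mule0.
by rewrite -!EFinD -EFinM => _; congr EFin; field; rewrite gt_eqF.
Qed.

(** Multiplying by [b] the image of Lebesgue measure under [x |-> a + b * x] gives
    back the length of intervals. *)
Lemma ge0_integral_affine (F : R -> \bar R) : measurable_fun setT F ->
  (forall x, (0 <= F x)%E) ->
  (\int[mu]_x F x = b%:E * \int[mu]_x F (a + b * x)%R)%E.
Proof.
move=> mF F0.
pose m : {measure set _ -> \bar R} :=
  mscale (NngNum (ltW b0)) (pushforward mu affine).
rewrite -(@eq_measure_integral _ _ _ _ mu (m measurable_affine))//.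
  by rewrite ge0_integral_mscale//= ge0_integral_pushforward.
by move=> A mA _; exact: affine_lebesgue.
Qed.

End affine_lebesgue.

Section gaussian_likelihood_ratio.
Context (R : realType).
Local Notation mu := (@lebesgue_measure R).
Local Notation gamma := (@normal_prob R 0 1).

Lemma ge0_integral_normal_prob (m s : R) (f : R -> \bar R) :
  measurable_fun setT f -> (forall x, (0 <= f x)%E) ->
  (\int[normal_prob m s]_x f x =
   \int[mu]_x (f x * (normal_pdf m s x)%:E))%E.
Proof.
move=> mf f0.
rewrite -(ge0_integral_with_density mu (measurable_normal_pdf m s)
  (normal_pdf_ge0 m s) mf f0).
exact: eq_measure_integral.
Qed.

Lemma sqrtr_expR_ln (x : R) : 0 < x -> Num.sqrt x = expR (2^-1 * ln x).
Proof. by move=> x0; rewrite -powR12_sqrt ?ltW// /powR gt_eqF. Qed.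

(** Likelihood ratio of N(a, b^2) with respect to N(0, 1). *)
Definition normal_lr (a b x : R) : R :=
  b^-1 * expR (x ^+ 2 / 2 - (x - a) ^+ 2 / (2 * b ^+ 2)).

Lemma measurable_normal_lr a b : measurable_fun setT (normal_lr a b).
Proof.
apply: measurable_funM => //; apply: measurableT_comp => //.
apply: measurable_funB; apply: measurable_funM => //=.
apply: measurable_funX; exact: measurable_funB.
Qed.

Lemma normal_lr_ge0 a b x : 0 < b -> 0 <= normal_lr a b x.
Proof. by move=> b0; rewrite mulr_ge0 ?expR_ge0// invr_ge0 ltW. Qed.

Lemma std_normal_pdfE x :
  normal_pdf 0 1 x = (Num.sqrt (pi *+ 2))^-1 * expR (- (x ^+ 2 / 2)) :> R.
Proof.
rewrite normal_pdfE ?oner_eq0// /normal_peak /normal_fun subr0 !expr1n !mul1r.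
by rewrite mulNr.
Qed.

(** This cancellation is the substitution rule between the two densities. *)
Lemma normal_lr_affine a b x : 0 < b ->
  normal_lr a b (a + b * x) * normal_pdf 0 1 (a + b * x) =
  b^-1 * normal_pdf 0 1 x.
Proof.
move=> b0; rewrite !std_normal_pdfE /normal_lr -!mulrA; congr (_ * _).
rewrite mulrCA; congr (_ * _); rewrite -expRD; congr expR.
by field; rewrite gt_eqF.
Qed.

Lemma normal_lr_change_of_measure (a b : R) (B : set R) : 0 < b -> measurable B ->
  (\int[gamma]_x (\1_B x * normal_lr a b x)%:E =
   gamma [set x | B (a + b * x)%R])%E.
Proof.
move=> b0 mB.
have mT : measurable_fun setT (fun x : R => a + b * x).
  by apply: measurable_funD => //; exact: measurable_funM.
have mBT : measurable [set x | B (a + b * x)].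
  by rewrite -[X in measurable X]setTI; exact: mT.
have ml : measurable_fun setT (fun x => (\1_B x * normal_lr a b x)%:E).
  apply/measurable_EFinP; apply: measurable_funM => //.
  exact: measurable_normal_lr.
rewrite ge0_integral_normal_prob//; last first.
  by move=> x; rewrite lee_fin mulr_ge0// normal_lr_ge0.
rewrite (ge0_integral_affine a b0)//; last 2 first.
- apply: emeasurable_funM => //; apply/measurable_EFinP.
  exact: measurable_normal_pdf.
- move=> x; rewrite mule_ge0// lee_fin ?normal_pdf_ge0//.
  by rewrite mulr_ge0// normal_lr_ge0.
rewrite -(setIT [set x | B _]) -integral_indic// ge0_integral_normal_prob//;
  last exact/measurable_EFinP.
rewrite -ge0_integralZl//; last 3 first.
- apply: emeasurable_funM; apply/measurable_EFinP.
    apply: measurable_funM; last first.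
      by apply: measurableT_comp => //; exact: measurable_normal_lr.
    by apply: measurableT_comp.
  by apply: measurableT_comp => //; exact: measurable_normal_pdf.
- move=> x _; rewrite mule_ge0// lee_fin ?normal_pdf_ge0//.
  by rewrite mulr_ge0// normal_lr_ge0.
- by rewrite lee_fin ltW.
apply: eq_integral => x _; rewrite -!EFinM; congr EFin.
rewrite -mulrA normal_lr_affine// mulrCA; congr (_ * _).
by rewrite mulrA divff ?mul1r ?gt_eqF.
Qed.

(** The integrand is, up to the stated factor, the density of a normal law
    with mean (1 + dl) a / (1 - dl v) and variance (1 + v) / (1 - dl v): this
    is obtained by completing the square. *)
Lemma normal_lr_moment a v dl : 0 <= v -> 0 <= dl -> dl * v < 1 ->
  (\int[gamma]_x ((normal_lr a (Num.sqrt (1 + v)) x) `^ (1 + dl))%:E =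
   (expR (dl * (1 + dl) * a ^+ 2 / (2 * (1 - dl * v))
          - 2^-1 * ln (1 - dl * v) - dl / 2 * ln (1 + v)))%:E)%E.
Proof.
move=> v0 dl0 dlv.
have v1 : 0 < 1 + v by lra.
set b := Num.sqrt (1 + v).
have b0 : 0 < b by rewrite sqrtr_gt0.
have b2 : b ^+ 2 = 1 + v by rewrite sqr_sqrtr// ltW.
have q0 : 0 < 1 - dl * v by lra.
set sd := Num.sqrt ((1 + v) / (1 - dl * v)).
have sd0 : 0 < sd by rewrite sqrtr_gt0 divr_gt0.
have sd2 : sd ^+ 2 = (1 + v) / (1 - dl * v).
  by rewrite sqr_sqrtr// ltW// divr_gt0.
set K := expR _.
rewrite ge0_integral_normal_prob; last 2 first.
- apply/measurable_EFinP.
  apply: (measurableT_comp (measurable_powR (1 + dl))).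
  exact: measurable_normal_lr.
- by move=> x; rewrite lee_fin powR_ge0.
set m := (1 + dl) * a / (1 - dl * v).
transitivity (\int[mu]_x (K%:E * (normal_pdf m sd x)%:E))%E.
  apply: eq_integral => x _; rewrite -!EFinM; congr EFin.
  have bE : b^-1 = expR (- (2^-1 * ln (1 + v))).
    by rewrite expRN -sqrtr_expR_ln.
  have sdE : sd^-1 = expR (2^-1 * ln (1 - dl * v) - 2^-1 * ln (1 + v)).
    rewrite expRB -!sqrtr_expR_ln// /sd sqrtrM ?ltW// sqrtrV ?ltW//.
    by rewrite invfM invrK mulrC.
  have -> : normal_pdf m sd x = (Num.sqrt (pi *+ 2))^-1 * (sd^-1 *
      expR (- ((x - m) ^+ 2 * (1 - dl * v) / (2 * (1 + v))))).
    rewrite normal_pdfE ?gt_eqF// /normal_peak /normal_fun sd2 mulrA.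
    congr (_ * expR _).
      rewrite -mulrnAr sqrtrM; last by rewrite divr_ge0// ltW.
      by rewrite invfM mulrC.
    by field; rewrite !gt_eqF.
  rewrite std_normal_pdfE /normal_lr -/b bE sdE -!expRD b2 -expRM.
  rewrite !mulrA ![_ * (Num.sqrt _)^-1]mulrC -!mulrA; congr (_ * _).
  rewrite -!expRD; congr expR; rewrite /m.
  by field; rewrite !gt_eqF.
rewrite ge0_integralZl//.
- by rewrite integral_normal_pdf mule1.
- by apply/measurable_EFinP; exact: measurable_normal_pdf.
- by move=> x _; rewrite lee_fin normal_pdf_ge0.
- by rewrite lee_fin expR_ge0.
Qed.

End gaussian_likelihood_ratio.

(** * The truncated second moment bound *)

Section truncated_second_moment.
Local Open Scope ereal_scope.
Context d (T : measurableType d) (R : realType) (P : probability T R).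

Local Notation EP f := (\int[P]_w (f w)%:E).

Let EP_le (f g : T -> R) : measurable_fun setT f -> measurable_fun setT g ->
  (forall w, (0 <= f w)%R) -> (forall w, (f w <= g w)%R) -> EP f <= EP g.
Proof.
move=> mf mg f0 fg; apply: ge0_le_integral => //.
- by move=> w _; rewrite lee_fin.
- exact/measurable_EFinP.
- exact/measurable_EFinP.
- by move=> w _; rewrite lee_fin.
Qed.

Let EPD (f g : T -> R) : measurable_fun setT f -> measurable_fun setT g ->
  (forall w, (0 <= f w)%R) -> (forall w, (0 <= g w)%R) ->
  EP (fun w => (f w + g w)%R) = EP f + EP g.
Proof.
move=> mf mg f0 g0; under eq_integral do rewrite EFinD.
by rewrite ge0_integralD//; (try exact/measurable_EFinP) => w _; rewrite lee_fin.
Qed.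

Let EPZ (c : R) (f : T -> R) : (0 <= c)%R -> measurable_fun setT f ->
  (forall w, (0 <= f w)%R) -> EP (fun w => (c * f w)%R) = c%:E * EP f.
Proof.
move=> c0 mf f0; under eq_integral do rewrite EFinM.
by rewrite ge0_integralZl// => [|w _]; [exact/measurable_EFinP|rewrite lee_fin].
Qed.

Let EP_cst (c : R) : EP (fun=> c) = c%:E.
Proof. by rewrite integral_cst//= probability_setT mule1. Qed.

Let EP_sum (I : finType) (f : I -> T -> R) :
  (forall i, measurable_fun setT (f i)) -> (forall i w, (0 <= f i w)%R) ->
  EP (fun w => (\sum_i f i w)%R) = \sum_i EP (f i).
Proof.
move=> mf f0; under eq_integral do rewrite -sumEFin.
rewrite ge0_integral_sum//.
- by move=> i; exact/measurable_EFinP.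
- by move=> i w _; rewrite lee_fin.
Qed.

Variables (l : nat) (L : 'I_l -> T -> R) (dl M : R).
Hypotheses (l0 : (0 < l)%N) (dl01 : (0 <= dl <= 1)%R) (M0 : (0 < M)%R).
Hypotheses (mL : forall j, measurable_fun setT (L j))
  (L0 : forall j w, (0 <= L j w)%R).
Hypothesis EL : forall j, EP (L j) = 1.
Hypothesis ELdl : forall j, EP (fun w => L j w `^ (1 + dl))%R <= M%:E.
Hypothesis indepL : forall j k, j != k -> independent_pair P (L j) (L k).

Let N : R := l%:R.
Let N0 : (0 < N)%R. Proof. by rewrite ltr0n. Qed.
Let rho : R := (M * N `^ (- dl))%R.
Let rho0 : (0 < rho)%R. Proof. by rewrite mulr_gt0// powR_gt0. Qed.

Let trunc (x : R) : R := (x * \1_[set y | y <= N] x)%R.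

Let measurable_trunc : measurable_fun setT trunc.
Proof.
apply: measurable_funM => //; apply: measurable_indic.
rewrite (_ : [set y | _] = [set` `]-oo, N]]); first exact: measurable_itv.
by apply/seteqP; split => y /=; rewrite in_itv.
Qed.

Let trunc_le x : (x <= N)%R -> trunc x = x.
Proof. by move=> xN; rewrite /trunc indicE mem_set// mulr1. Qed.

Let trunc_gt x : (N < x)%R -> trunc x = 0%R.
Proof.
move=> xN; rewrite /trunc indicE memNset ?mulr0//= => /(lt_le_trans xN).
by rewrite ltxx.
Qed.

Let trunc_ge0 x : (0 <= x)%R -> (0 <= trunc x)%R.
Proof. by move=> x0; rewrite mulr_ge0. Qed.

Let trunc_lex x : (0 <= x)%R -> (trunc x <= x)%R.
Proof. by have [/trunc_le->|/trunc_gt->] := leP x N. Qed.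

(* Beyond [N] the factor [(x / N) `^ dl] is at least 1. *)
Let tail_bound x : (0 <= x)%R ->
  (x <= trunc x + N `^ (- dl) * x `^ (1 + dl))%R.
Proof.
move=> x0; have [xN|xN] := leP x N.
  by rewrite trunc_le// lerDl mulr_ge0// powR_ge0.
have xp : (0 < x)%R by exact: lt_trans xN.
rewrite trunc_gt// add0r.
have -> : (x `^ (1 + dl) = x * x `^ dl)%R.
  by rewrite powRD ?(gt_eqF xp) ?implybT// powRr1.
rewrite mulrCA.
rewrite ler_pMr// powRN mulrC ler_pdivlMr ?powR_gt0// mul1r.
have /andP[dl0 _] := dl01.
by apply: ge0_ler_powR => //; rewrite ?nnegrE ltW.
Qed.

(* Up to [N], [x ^ 2] is [x `^ (1 + dl)] times [x `^ (1 - dl) <= N `^ (1 - dl)]. *)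
Let square_bound x : (0 <= x)%R ->
  (trunc x * trunc x <= N * N `^ (- dl) * x `^ (1 + dl))%R.
Proof.
move=> x0; have [xN|xN] := leP x N; last first.
  by rewrite trunc_gt// mulr0 !mulr_ge0// ?powR_ge0// ltW.
rewrite trunc_le//.
have [->|xn0] := eqVneq x 0%R.
  by rewrite mulr0 !mulr_ge0// ?powR_ge0// ltW.
have xp : (0 < x)%R by rewrite lt_neqAle eq_sym xn0.
have /andP[dl0 dl1] := dl01.
have -> : (x * x = x `^ (1 - dl) * x `^ (1 + dl))%R.
  rewrite -powRD ?xn0 ?implybT//.
  by rewrite (_ : 1 - dl + (1 + dl) = 2)%R; [rewrite powR_mulrn|ring].
rewrite ler_wpM2r ?powR_ge0//.
have -> : (N * N `^ (- dl) = N `^ (1 - dl))%R.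
  by rewrite powRD ?(gt_eqF N0) ?implybT// powRr1// ltW.
by apply: ge0_ler_powR; rewrite ?nnegrE ?subr_ge0// ltW.
Qed.

Let Tj j w : R := trunc (L j w).

Let measurable_Tj j : measurable_fun setT (Tj j).
Proof. by apply: measurableT_comp => //; exact: mL. Qed.

Let Tj0 j w : (0 <= Tj j w)%R. Proof. exact: trunc_ge0. Qed.

Let Tj_le1 j : EP (Tj j) <= 1.
Proof. by rewrite -(EL j); apply: EP_le => // w; exact: trunc_lex. Qed.

Let p j : R := fine (EP (Tj j)).

Let pE j : EP (Tj j) = (p j)%:E.
Proof.
rewrite fineK// ge0_fin_numE ?(le_lt_trans (Tj_le1 j)) ?ltry//.
by apply: integral_ge0 => w _; rewrite lee_fin.
Qed.

Let p_ge0 j : (0 <= p j)%R.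
Proof. by rewrite -lee_fin -pE; apply: integral_ge0 => w _; rewrite lee_fin. Qed.

Let p_le1 j : (p j <= 1)%R. Proof. by rewrite -lee_fin -pE. Qed.

Let ETT j : EP (fun w => Tj j w * Tj j w)%R <= (N * rho)%:E.
Proof.
have mpow : measurable_fun setT (fun w => L j w `^ (1 + dl))%R.
  exact: (measurableT_comp (measurable_powR (1 + dl))).
apply: (@le_trans _ _ (EP (fun w => N * N `^ (- dl) * L j w `^ (1 + dl))%R)).
  apply: EP_le => //; [exact: measurable_funM|exact: measurable_funM| |].
    by move=> w; rewrite mulr_ge0.
  by move=> w; exact: square_bound.
rewrite EPZ//; last by move=> w; rewrite powR_ge0.
  apply: le_trans; first by apply: lee_wpmul2l (ELdl j); rewrite lee_fin mulr_ge0// ?powR_ge0// ltW.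
  by rewrite -EFinM lee_fin /rho [(M * _)%R]mulrC mulrA lexx.
by rewrite mulr_ge0 ?powR_ge0// ltW.
Qed.

Let ETjk j k : j != k -> EP (fun w => Tj j w * Tj k w)%R = (p j * p k)%:E.
Proof.
move=> jk; under eq_integral do rewrite EFinM.
(* The absolute value makes the truncation nonnegative on the whole line. *)
have mt : measurable_fun setT (EFin \o (fun x : R => trunc `|x|%R)).
  by apply/measurable_EFinP; apply: measurableT_comp.
have t0 x : 0 <= (EFin \o (fun x : R => trunc `|x|%R)) x.
  by rewrite lee_fin trunc_ge0.
have := independent_ge0_integralM (mL j) (mL k) (indepL jk) mt mt t0 t0.
rewrite /=.
have nE i w : `|L i w|%R = L i w by rewrite ger0_norm.
under eq_integral do rewrite !nE.
move=> ->; rewrite EFinM -!pE; congr (_ * _); apply: eq_integral => w _;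
  by rewrite nE.
Qed.

Let S w : R := (\sum_j Tj j w)%R.
Let s : R := (\sum_j p j)%R.

Let measurable_S : measurable_fun setT S.
Proof. exact: measurable_sum. Qed.

Let S0 w : (0 <= S w)%R. Proof. exact: sumr_ge0. Qed.

Let s_ge0 : (0 <= s)%R. Proof. exact: sumr_ge0. Qed.

Let s_leN : (s <= N)%R.
Proof.
have -> : N = (\sum_(j < l) 1)%R by rewrite sumr_const card_ord.
exact: ler_sum.
Qed.

Let ES : EP S = s%:E.
Proof. by rewrite EP_sum// -sumEFin; apply: eq_bigr. Qed.

Let ESS : EP (fun w => S w * S w)%R <= (N * (N * rho) + s * s)%:E.
Proof.
under eq_integral do rewrite /S big_distrlr/= pair_bigA/=.
rewrite EP_sum/=; last 2 first.
- by move=> i; exact: measurable_funM.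
- by move=> i w; exact: mulr_ge0.
have -> : (N * (N * rho) + s * s =
  \sum_(i : 'I_l * 'I_l) ((i.1 == i.2)%:R * (N * rho) + p i.1 * p i.2))%R.
  rewrite big_split/= -(pair_bigA _ (fun i j => p i * p j)%R)/=.
  rewrite -(pair_bigA _ (fun i j => (i == j)%:R * (N * rho))%R)/=.
  rewrite /s big_distrlr/=; congr (_ + _)%R.
  rewrite (eq_bigr (fun=> N * rho)%R); first by rewrite sumr_const card_ord mulr_natl.
  move=> i _; rewrite (bigD1 i)//= eqxx mul1r big1 ?addr0// => j ji.
  by rewrite eq_sym (negbTE ji) mul0r.
rewrite -sumEFin; apply: lee_sum => -[j k] _ /=.
have [<-|jk] := eqVneq j k; last by rewrite mul0r add0r ETjk.
apply: (le_trans (ETT j)).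
by rewrite mul1r lee_fin lerDl mulr_ge0.
Qed.

(* The integral of [\1_D * (S - s)] is bounded with the pointwise inequality
   [u <= N * t / 2 + u ^ 2 / (2 * N * t)].  The terms are arranged so that
   only nonnegative functions are integrated. *)
Let main_term (D : set T) : measurable D -> forall t, (0 < t)%R ->
  EP (fun w => \1_D w * S w)%R <=
  s%:E * P D + (N * t / 2 + N * rho / (2 * t))%:E.
Proof.
move=> mD t t0.
have m1 : measurable_fun setT (\1_D : T -> R) by exact: measurable_indic.
have mDS : measurable_fun setT (fun w => \1_D w * S w)%R.
  exact: measurable_funM.
have mSS : measurable_fun setT (fun w => S w * S w)%R by exact: measurable_funM.
have c10 : (0 <= s / (N * t))%R by rewrite divr_ge0// mulr_ge0// ltW.
have c20 : (0 <= (2 * (N * t))^-1)%R by rewrite invr_ge0 !mulr_ge0// ltW.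
set c1 := (s / (N * t))%R in c10 *; set c2 := ((2 * (N * t))^-1)%R in c20 *.
set c3 := (N * t / 2 + s ^+ 2 * c2)%R.
have c30 : (0 <= c3)%R.
  by rewrite addr_ge0// ?mulr_ge0// ?sqr_ge0// ltW.
have key : EP (fun w => \1_D w * S w + c1 * S w)%R <=
           EP (fun w => (s * \1_D w + (c3 + c2 * (S w * S w))))%R.
  apply: EP_le.
  - by apply: measurable_funD => //; exact: measurable_funM.
  - apply: measurable_funD; first exact: measurable_funM.
    by apply: measurable_funD => //; exact: measurable_funM.
  - by move=> w; rewrite addr_ge0// mulr_ge0.
  - move=> w.
    have -> : (s * \1_D w + (c3 + c2 * (S w * S w)) =
        \1_D w * S w + c1 * S w + (N * t / 2 - \1_D w * (S w - s) + c2 * (S w - s) ^+ 2))%R.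
      by rewrite /c3 /c1 /c2; field; rewrite !gt_eqF.
    rewrite lerDl.
    have -> : (N * t / 2 - \1_D w * (S w - s) + c2 * (S w - s) ^+ 2 =
      c2 * ((N * t - \1_D w * (S w - s)) ^+ 2 + (1 - \1_D w ^+ 2) * (S w - s) ^+ 2))%R.
      by rewrite /c2; field; rewrite !gt_eqF.
    rewrite mulr_ge0// addr_ge0 ?sqr_ge0// mulr_ge0 ?sqr_ge0// subr_ge0.
move: key; rewrite EPD//; last 3 first.
- exact: measurable_funM.
- by move=> w; rewrite mulr_ge0.
- by move=> w; rewrite mulr_ge0.
rewrite (EPZ c10)// ES EPD//; last 4 first.
- exact: measurable_funM.
- by apply: measurable_funD => //; exact: measurable_funM.
- by move=> w; rewrite mulr_ge0.
- by move=> w; rewrite addr_ge0// mulr_ge0// mulr_ge0.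
rewrite EPZ// integral_indic// setIT EPD//; last 2 first.
- exact: measurable_funM.
- by move=> w; rewrite mulr_ge0// mulr_ge0.
rewrite EP_cst (EPZ c20)//; last by move=> w; rewrite mulr_ge0.
move=> key.
have {key} : EP (fun w => \1_D w * S w)%R + (c1 * s)%:E <=
   s%:E * P D + (c3 + c2 * (N * (N * rho) + s * s))%:E.
  rewrite EFinM; apply: (le_trans key); apply: leeD2l.
  rewrite [leRHS]EFinD [X in _ <= _ + X]EFinM; apply: leeD2l.
  by rewrite lee_wpmul2l// lee_fin.
rewrite -leeBrDr// => /le_trans; apply.
rewrite -addeA; apply: leeD2l; rewrite -EFinN -EFinD lee_fin /c3 /c1 /c2.
rewrite le_eqVlt; apply/orP; left; apply/eqP.
by field; rewrite !gt_eqF.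
Qed.

(** Truncation at [l] balances the two errors: the mean of the truncated ratios
    has variance at most [rho], and what is cut off from a ratio has expectation
    at most [rho]. *)
Lemma sum_likelihood_ratio_le (D : set T) : measurable D ->
  \sum_j \int[P]_(w in D) (L j w)%:E <=
  N%:E * (P D + (rho + Num.sqrt rho)%:E).
Proof.
move=> mD.
have m1 : measurable_fun setT (\1_D : T -> R) by exact: measurable_indic.
have mpow j : measurable_fun setT (fun w => L j w `^ (1 + dl))%R.
  exact: (measurableT_comp (measurable_powR (1 + dl))).
have tail j : \int[P]_(w in D) (L j w)%:E <=
    EP (fun w => \1_D w * Tj j w)%R + rho%:E.
  rewrite integral_mkcond.
  apply: (@le_trans _ _ (EP (fun w => \1_D w * Tj j w +
      N `^ (- dl) * L j w `^ (1 + dl))%R)).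
    rewrite (eq_integral (fun w => (\1_D w * L j w)%:E)); last first.
      move=> w _; rewrite patchE indicE; case: ifP => _; first by rewrite mul1r.
      by rewrite mul0r.
    apply: EP_le; [exact: measurable_funM| | by move=> w; exact: mulr_ge0|].
      by apply: measurable_funD => //; exact: measurable_funM.
    move=> w; rewrite indicE; case: (_ \in _).
      by rewrite !mul1r tail_bound.
    by rewrite !mul0r add0r mulr_ge0// powR_ge0.
  rewrite EPD; last 4 first.
  - exact: measurable_funM.
  - exact: measurable_funM.
  - by move=> w; exact: mulr_ge0.
  - by move=> w; rewrite mulr_ge0// powR_ge0.
  apply: leeD2l; rewrite EPZ ?powR_ge0//; last by move=> w; rewrite powR_ge0.
  rewrite /rho mulrC EFinM lee_wpmul2l// lee_fin powR_ge0//.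
apply: (@le_trans _ _ (\sum_j (EP (fun w => \1_D w * Tj j w)%R + rho%:E))).
  by apply: lee_sum => j _.
rewrite big_split/= -EP_sum; last 2 first.
- by move=> j; exact: measurable_funM.
- by move=> j w; exact: mulr_ge0.
under eq_integral do rewrite -mulr_sumr.
have r0 : (0 < Num.sqrt rho)%R by rewrite sqrtr_gt0.
apply: (@le_trans _ _ (s%:E * P D +
   (N * Num.sqrt rho / 2 + N * rho / (2 * Num.sqrt rho))%:E +
   \sum_(j < l) rho%:E)).
  by apply: leeD2r; apply: main_term.
rewrite -addeA ge0_muleDr//; last by rewrite lee_fin addr_ge0// ltW.
apply: leeD; first by rewrite lee_wpmul2r// lee_fin.
rewrite sumEFin -EFinD -EFinM lee_fin sumr_const card_ord -mulr_natl -/N.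
(* [t = sqrt rho] minimizes [t / 2 + rho / (2 * t)]. *)
have : rho = (Num.sqrt rho ^+ 2)%R by rewrite sqr_sqrtr// ltW.
move: r0; move: (Num.sqrt rho) => r r0 ->.
rewrite le_eqVlt; apply/orP; left; apply/eqP.
by field; rewrite gt_eqF.
Qed.

End truncated_second_moment.

Lemma independent_pair_comp d d1 d2 d1' d2' (T : measurableType d)
    (E1 : measurableType d1) (E2 : measurableType d2)
    (F1 : measurableType d1') (F2 : measurableType d2') (R : realType)
    (P : probability T R) (U : T -> E1) (V : T -> E2)
    (f : E1 -> F1) (g : E2 -> F2) :
  measurable_fun setT f -> measurable_fun setT g ->
  independent_pair P U V -> independent_pair P (f \o U) (g \o V).
Proof.
move=> mf mg UV A B mA mB; apply: (UV (f @^-1` A) (g @^-1` B)).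
  by rewrite -[X in measurable X]setTI; exact: mf.
by rewrite -[X in measurable X]setTI; exact: mg.
Qed.

Lemma powR_prod (R : realType) (I : finType) (Q : pred I) (f : I -> R) (r : R) :
  (forall i, 0 <= f i) ->
  (\prod_(i | Q i) f i) `^ r = \prod_(i | Q i) (f i) `^ r.
Proof.
move=> f0; suff [] : (\prod_(i | Q i) f i) `^ r = \prod_(i | Q i) (f i) `^ r /\
    0 <= \prod_(i | Q i) f i by [].
elim/big_rec2: _ => [|i x y _ [<- y0]]; first by rewrite powR1.
by rewrite powRM// mulr_ge0.
Qed.

(** * Change of measure on a block *)

Section block_likelihood_ratio.
Context (R : realType) (d : measure_display) (T : measurableType d)
  (P : probability T R) (n : nat) (Z : 'I_n -> {RV P >-> R}).
Hypothesis HZ : iid_std_normal Z.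
Local Notation gamma := (@normal_prob R 0 1).

Lemma ge0_integral_std_normal i (f : R -> \bar R) : measurable_fun setT f ->
  (forall x, (0 <= f x)%E) ->
  (\int[P]_w f (Z i w) = \int[gamma]_x f x)%E.
Proof.
move=> mf f0; rewrite -(ge0_integral_distribution (Z i))//.
(* The two sides use different presentations of the Borel sets of [R]; the
   identity map transports one to the other. *)
pose phi (x : measurableTypeR R) : R := x.
have mphi : measurable_fun setT phi by move=> _ B mB; rewrite setTI.
pose nu : {measure set R -> \bar R} := pushforward gamma phi.
transitivity (\int[nu mphi]_x f x)%E; last by rewrite ge0_integral_pushforward.
by apply: eq_measure_integral => A mA _; exact: HZ.2.
Qed.

Definition block_lr (a b : R) (J : {set 'I_n}) (w : T) : R :=
  \prod_(i in J) normal_lr a b (Z i w).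

Lemma measurable_block_lr a b J : measurable_fun setT (block_lr a b J).
Proof.
apply: measurable_prod_cond => i; apply: measurableT_comp => //.
exact: measurable_normal_lr.
Qed.

Lemma block_lr_ge0 a b J w : 0 < b -> 0 <= block_lr a b J w.
Proof. by move=> b0; apply: prodr_ge0 => i _; exact: normal_lr_ge0. Qed.

Lemma independent_block_lr a b (J K : {set 'I_n}) :
  {in J, forall i, i \notin K} ->
  independent_pair P (block_lr a b J) (block_lr a b K).
Proof.
move=> JK.
pose F (L : {set 'I_n}) (t : n.-tuple R) : R :=
  \prod_(i in L) normal_lr a b (tnth t i).
have mF L : measurable_fun setT (F L).
  apply: measurable_prod_cond => i.
  apply: (measurableT_comp (measurable_normal_lr a b)).
  exact: measurable_tnth.
have FE L : block_lr a b L = F L \o subfamily Z L.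
  apply/funext => w; apply: eq_bigr => i iL.
  by rewrite tnth_mktuple iL.
rewrite !FE; apply: independent_pair_comp => //.
exact: (independent_subfamilies HZ.1).
Qed.

Lemma integral_block_lr_powR a b r J : 0 < b ->
  (\int[P]_w (block_lr a b J w `^ r)%:E =
   \prod_(i in J) \int[gamma]_x (normal_lr a b x `^ r)%:E)%E.
Proof.
move=> b0; under eq_integral.
  move=> w _; rewrite powR_prod; last by move=> i; exact: normal_lr_ge0.
  over.
have mf : measurable_fun setT (fun x => normal_lr a b x `^ r).
  apply: (measurableT_comp (measurable_powR r)).
  exact: measurable_normal_lr.
rewrite (mutually_independent_ge0_integral_prod HZ.1
  (f := fun _ x => normal_lr a b x `^ r))//; last by move=> i x; exact: powR_ge0.
apply: eq_bigr => i _.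
rewrite (ge0_integral_std_normal i (f := fun x => (normal_lr a b x `^ r)%:E))//.
- exact/measurable_EFinP.
- by move=> x; rewrite lee_fin powR_ge0.
Qed.

(** The law of the shifted observations has density [block_lr] with respect to
    the null law.  On a box both sides are products over the coordinates. *)
Lemma block_lr_change_of_measure (s0 a b : R) (J : {set 'I_n})
    (A : set (n.-tuple R)) : 0 < b -> measurable A ->
  P [set w | A [tuple s0 * (if i \in J then a + b * Z i w else Z i w)
               | i < n]] =
  (\int[P]_(w in [set w | A [tuple (s0 * Z i w)%R | i < n]])
     (block_lr a b J w)%:E)%E.
Proof.
move=> b0 mA.
pose shift (i : 'I_n) (x : R) := if i \in J then a + b * x else x.
pose lr (i : 'I_n) (x : R) := if i \in J then normal_lr a b x else 1.
pose Y1 w : n.-tuple R := [tuple s0 * shift i (Z i w) | i < n].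
pose Y0 w : n.-tuple R := [tuple s0 * Z i w | i < n].
have mshift i : measurable_fun setT (shift i).
  rewrite /shift; case: (i \in J) => //.
  by apply: measurable_funD => //; exact: measurable_funM.
have mlr i : measurable_fun setT (lr i).
  by rewrite /lr; case: (i \in J) => //; exact: measurable_normal_lr.
have lr0 i x : 0 <= lr i x.
  by rewrite /lr; case: (i \in J) => //; exact: normal_lr_ge0.
have mY1 : measurable_fun setT Y1.
  apply/measurable_fun_tnthP => i.
  rewrite (_ : _ \o _ = fun w => s0 * shift i (Z i w)).
    by apply: measurable_funM => //; exact: measurableT_comp.
  by apply/funext => w /=; rewrite tnth_mktuple.
have mY0 : measurable_fun setT Y0.
  apply/measurable_fun_tnthP => i.
  rewrite (_ : _ \o _ = fun w => s0 * Z i w).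
    exact: measurable_funM.
  by apply/funext => w /=; rewrite tnth_mktuple.
have mL := measurable_block_lr a b J.
have L0 w : 0 <= block_lr a b J w by exact: block_lr_ge0.
pose m1 : {measure set _ -> \bar R} := pushforward P Y1.
pose m2 : {measure set _ -> \bar R} := pushforward (with_density P mL L0) Y0.
change (m1 mY1 A = m2 mY0 A).
apply: measure_tuple_unique => //.
  by rewrite /m1 /= /pushforward preimage_setT probability_setT ltry.
move=> B mB; rewrite /m1 /m2 /= /pushforward /with_density.
pose C i : set R := [set x | B i (s0 * x)].
have mC i : measurable (C i).
  rewrite -[X in measurable X]setTI.
  by have := measurable_funM (measurable_cst s0) (@measurable_id _ R setT);
    apply.
have mCs i : measurable (shift i @^-1` C i).
  by rewrite -[X in measurable X]setTI; exact: mshift.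
have -> : Y1 @^-1` tuple_box B = [set w | forall i, (shift i @^-1` C i) (Z i w)].
  by apply/seteqP; split => w /= H i; have := H i; rewrite tnth_mktuple.
rewrite (mutually_independent_all HZ.1 mCs).
transitivity (\int[P]_w (\prod_i (\1_(C i) (Z i w) * lr i (Z i w)))%:E)%E.
  pose f (i : 'I_n) (x : R) := \1_(C i) x * lr i x.
  have mf i : measurable_fun setT (f i).
    by apply: measurable_funM => //; exact: measurable_indic.
  have f0 i x : 0 <= f i x by rewrite mulr_ge0.
  have := mutually_independent_ge0_integral_prod HZ.1 mf f0 [set: 'I_n]%SET.
  have setTE : (fun i : 'I_n => i \in [set: 'I_n]%SET) =1 xpredT.
    by move=> i; rewrite finset.in_setT.
  rewrite (eq_bigl _ _ setTE).
  under eq_integral do rewrite (eq_bigl _ _ setTE).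
  move=> ->; apply: eq_bigr => i _.
  rewrite (ge0_integral_std_normal i (f := fun x => (f i x)%:E)); last 2 first.
  - exact/measurable_EFinP.
  - by move=> x; rewrite lee_fin.
  have -> : P (Z i @^-1` (shift i @^-1` C i)) = gamma (shift i @^-1` C i).
    exact: HZ.2.
  rewrite /f /lr /shift; case: (i \in J).
    by rewrite normal_lr_change_of_measure.
  under eq_integral do rewrite mulr1.
  rewrite integral_indic//; last exact: mC.
  by congr (gamma _); apply/seteqP; split => [x|x []].
rewrite [RHS]integral_mkcond; apply: eq_integral => w _.
rewrite patchE big_split/= /block_lr [in RHS]big_mkcond/=.
have [H|H] := pselect (forall i, C i (Z i w)).
  rewrite big1 ?mul1r; last by move=> i _; rewrite indicE mem_set.
  rewrite mem_set// => i /=; rewrite tnth_mktuple; exact: H.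
rewrite memNset/=; last first.
  by move=> H'; apply: H => i; have := H' i; rewrite tnth_mktuple.
have /existsNP[i Ci] := H.
by rewrite (bigD1 i)//= indicE memNset// !mul0r.
Qed.

End block_likelihood_ratio.

(** * The finite sample bound *)

(** Kullback-Leibler divergence of N(a, 1 + v) from N(0, 1). *)
Definition bump_kl (R : realType) (a v : R) : R :=
  (v + a ^+ 2 - ln (1 + v)) / 2.

Section log_moment.
Context (R : realType).
Implicit Types a v dl x : R.

Let ln_bound x : 0 <= x -> x <= 2^-1 -> - ln (1 - x) <= x + 2 * x ^+ 2.
Proof.
move=> x0 x1; have y0 : 0 < 1 - x by lra.
rewrite -lnV ?posrE//.
have -> : (1 - x)^-1 = 1 + x / (1 - x) by field; rewrite gt_eqF.
apply: (le_trans (le_ln1Dx _)).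
  by rewrite (lt_le_trans (y := 0))// divr_ge0// ltW.
by rewrite ler_pdivrMr//; nra.
Qed.

(** To first order in [dl] the logarithm of the moment is [dl * bump_kl a v]; the
    condition [dl * v <= 2^-1] keeps [1 - dl * v] away from 0 in the second
    order terms. *)
Lemma log_moment_le a v dl : 0 <= v -> 0 <= dl -> dl * v <= 2^-1 ->
  dl * (1 + dl) * a ^+ 2 / (2 * (1 - dl * v)) - 2^-1 * ln (1 - dl * v)
    - dl / 2 * ln (1 + v) <=
  dl * bump_kl a v + dl ^+ 2 * (v ^+ 2 + a ^+ 2 * (1 + v)).
Proof.
move=> v0 dl0 x1; have x0 : 0 <= dl * v by exact: mulr_ge0.
have := ln_bound x0 x1; rewrite /bump_kl.
have y0 : 0 < 1 - dl * v by lra.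
have : dl * (1 + dl) * a ^+ 2 / (2 * (1 - dl * v)) <=
    dl * a ^+ 2 / 2 + dl ^+ 2 * (a ^+ 2 * (1 + v)).
  have A0 : 0 <= dl * a ^+ 2 by rewrite mulr_ge0// sqr_ge0.
  rewrite ler_pdivrMr; last by rewrite mulr_gt0.
  have -> : dl * (1 + dl) * a ^+ 2 = (dl * a ^+ 2) * (1 + dl) by ring.
  have -> : (dl * a ^+ 2 / 2 + dl ^+ 2 * (a ^+ 2 * (1 + v))) * (2 * (1 - dl * v))
    = (dl * a ^+ 2) * ((1 + 2 * dl * (1 + v)) * (1 - dl * v)) by field.
  rewrite ler_wpM2l//; nra.
nra.
Qed.

Lemma bump_kl_ge0 a v : 0 <= v -> 0 <= bump_kl a v.
Proof.
move=> v0; rewrite /bump_kl divr_ge0//.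
have := le_ln1Dx (lt_le_trans (ltrN10 R) v0).
by have := sqr_ge0 a; lra.
Qed.

End log_moment.

Section finite_sample_bound.
Context (R : realType) (d : measure_display) (T : measurableType d)
  (P : probability T R) (n : nat) (Z : 'I_n -> {RV P >-> R}).
Hypothesis HZ : iid_std_normal Z.
Variables (s0 Delta s h : R) (Phi : {mfun n.-tuple R >-> bool}).
Hypotheses (Hs0 : 0 < s0) (n0 : (0 < n)%N) (h0 : 0 < h)
  (hl : h^-1 \is a Num.nat) (hm : n%:R * h \is a Num.nat).

Let a := Delta / s0.
Let v := (s / s0) ^+ 2.
Let b := Num.sqrt (1 + v).

Let v0 : 0 <= v. Proof. exact: sqr_ge0. Qed.
Let b0 : 0 < b. Proof. by rewrite sqrtr_gt0 ltr_pwDl. Qed.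

Let l := Num.truncn h^-1.
Let m := Num.truncn (n%:R * h).

Let lE : h^-1 = l%:R. Proof. by rewrite truncnK. Qed.
Let mE : n%:R * h = m%:R. Proof. by rewrite truncnK. Qed.
Let l0 : (0 < l)%N. Proof. by rewrite -(ltr0n R) -lE invr_gt0. Qed.
Let m0 : (0 < m)%N. Proof. by rewrite -(ltr0n R) -mE mulr_gt0// ltr0n. Qed.

Let block (j : nat) : {set 'I_n} := [set i : 'I_n | (i %/ m)%N == j]%SET.

Let interval (j : nat) : set R := [set x | j%:R * h < x <= j.+1%:R * h].

(* The design point of index [i] is [i.+1 / n], and an interval contains its
   right end point but not its left one: hence the blocks are the classes of
   [i %/ m]. *)
Let in_interval j (i : 'I_n) : \1_(interval j) (i.+1%:R / n%:R) =
  (i \in block j)%:R :> R.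
Proof.
rewrite indicE finset.inE; congr ((nat_of_bool _)%:R).
apply/idP/idP; rewrite ?in_setE /interval /=.
  rewrite ltr_pdivlMr ?ltr0n// ler_pdivrMr ?ltr0n//.
  rewrite -!mulrA ![h * _]mulrC mE -!natrM ltr_nat ler_nat => /andP[h1 h2].
  by rewrite eqn_leq -ltnS ltn_divLR// h2 leq_divRL.
move=> /eqP ij.
rewrite ltr_pdivlMr ?ltr0n// ler_pdivrMr ?ltr0n//.
rewrite -!mulrA ![h * _]mulrC mE -!natrM ltr_nat ler_nat.
by rewrite ltnS -leq_divRL// -ltn_divLR// ij leqnn ltnSn.
Qed.

Let card_block j : (#|block j| <= m)%N.
Proof.
rewrite cardE -(size_map val) -[leqRHS](size_iota (j * m)).
apply: uniq_leq_size; first by rewrite map_inj_uniq ?enum_uniq//; exact: val_inj.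
move=> _ /mapP[i + ->]; rewrite mem_enum finset.inE mem_iota => /eqP ij /=.
by rewrite -leq_divRL// -mulSnr -ltn_divLR// ij leqnn ltnSn.
Qed.

Let candidate (j : 'I_l) : candidate_intervals h (interval j).
Proof. by exists j.+1 => //=; split => //; rewrite lE ler_nat. Qed.

Let Y0 (w : T) : n.-tuple R := [tuple s0 * Z i w | i < n].

Let null_obs w : hbr_obs Z (cst 0) (cst s0) w = Y0 w.
Proof. by apply: eq_mktuple => i; rewrite add0r. Qed.

Let bump_obs j w :
  hbr_obs Z (bump_mean Delta (interval j)) (bump_sd s0 s (interval j)) w =
  [tuple s0 * (if i \in block j then a + b * Z i w else Z i w) | i < n].
Proof.
apply: eq_mktuple => i; rewrite /bump_mean /bump_sd in_interval.
case: (i \in block j) => /=; last first.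
  by rewrite !mulr0 add0r addr0 sqrtr_sqr gtr0_norm.
rewrite !mulr1 mulrDr mulrCA divff ?gt_eqF// mulr1; congr (_ + _).
rewrite mulrA; congr (_ * _).
have -> : s0 ^+ 2 + s ^+ 2 = s0 ^+ 2 * (1 + v).
  by rewrite /v; field; rewrite gt_eqF.
by rewrite sqrtrM ?sqr_ge0// sqrtr_sqr gtr0_norm.
Qed.

Let A : set (n.-tuple R) := Phi @^-1` [set true].

Let mA : measurable A.
Proof. by rewrite -[X in measurable X]setTI; exact: measurable_funP. Qed.

Let D : set T := Y0 @^-1` A.

Let mD : measurable D.
Proof.
rewrite -[X in measurable X]setTI.
have mY0 : measurable_fun setT Y0.
  apply/measurable_fun_tnthP => i.
  rewrite (_ : _ \o _ = fun w => s0 * Z i w); first exact: measurable_funM.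
  by apply/funext => w /=; rewrite tnth_mktuple.
exact: mY0.
Qed.

Let type1E : type1_error Z s0 Phi = P D.
Proof.
rewrite /type1_error; congr (P _); apply/seteqP.
by split => w /=; rewrite null_obs.
Qed.

Let L (j : 'I_l) := block_lr Z a b (block j).

Let power_le (j : 'I_l) :
  (1 - type2_error Z s0 Delta s h Phi <= \int[P]_(w in D) (L j w)%:E)%E.
Proof.
rewrite -(block_lr_change_of_measure HZ s0 a (block j) b0 mA).
set E1 := [set w | _].
have mE1 : measurable E1.
  rewrite -[X in measurable X]setTI.
  have mY : measurable_fun setT (fun w =>
      [tuple s0 * (if i \in block j then a + b * Z i w else Z i w) | i < n]).
    apply/measurable_fun_tnthP => i.
    rewrite (_ : _ \o _ = fun w =>
        s0 * (if i \in block j then a + b * Z i w else Z i w)).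
      apply: measurable_funM => //; case: (i \in block j) => //.
      by apply: measurable_funD => //; exact: measurable_funM.
    by apply/funext => w /=; rewrite tnth_mktuple.
  exact: mY.
have -> : P E1 = (1 - P (~` E1))%E.
  by rewrite -probability_setC ?setCK//; exact: measurableC.
apply: leeB => //; apply: ereal_sup_ubound; exists (interval j).
  exact: candidate.
congr (P _); apply/seteqP; split => w /=; rewrite bump_obs /E1 /A /=.
  by move=> ->.
by case: (Phi _) => // /(_ erefl).
Qed.

(** The power is at most the integral of each block likelihood ratio over the
    rejection event [D], hence at most their mean. *)
Lemma power_le_type1_error (dl rho : R) : 0 <= dl <= 1 -> dl * v <= 2^-1 ->
  rho = expR (n%:R * h *
      (dl * bump_kl a v + dl ^+ 2 * (v ^+ 2 + a ^+ 2 * (1 + v))) +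
      dl * ln h) ->
  (1 - type2_error Z s0 Delta s h Phi <=
   type1_error Z s0 Phi + (rho + Num.sqrt rho)%:E)%E.
Proof.
move=> dl01 dlv; have /andP[dl0 dl1] := dl01.
set c := dl * bump_kl a v + _.
have c0 : 0 <= c.
  rewrite addr_ge0// mulr_ge0// ?bump_kl_ge0// ?sqr_ge0//.
  by rewrite addr_ge0 ?sqr_ge0// mulr_ge0 ?sqr_ge0// addr_ge0.
move=> rho_def.
pose M := expR (n%:R * h * c).
have rhoE : rho = M * l%:R `^ (- dl).
  rewrite rho_def expRD; congr (_ * _).
  by rewrite -lE /powR gt_eqF ?invr_gt0// lnV ?posrE// mulrNN.
have EL j : (\int[P]_w (L j w)%:E = 1)%E.
  have setTE (Y : T -> n.-tuple R) : [set w | [set: n.-tuple R] (Y w)] = setT.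
    by apply/seteqP; split.
  have := block_lr_change_of_measure HZ s0 a (block j) b0 measurableT.
  by rewrite !setTE probability_setT.
have ELdl j : (\int[P]_w (L j w `^ (1 + dl))%:E <= M%:E)%E.
  rewrite integral_block_lr_powR//.
  have dlv1 : dl * v < 1 by apply: (le_lt_trans dlv); lra.
  rewrite (eq_bigr _ (fun i _ => normal_lr_moment a v0 dl0 dlv1)).
  rewrite prodEFin prodr_const lee_fin -expRM_natl /M ler_expR mE.
  apply: (@le_trans _ _ (#|block j|%:R * c)).
    by rewrite ler_wpM2l// log_moment_le.
  by rewrite ler_wpM2r// ler_nat.
have indepL j k : j != k -> independent_pair P (L j) (L k).
  move=> jk; apply: independent_block_lr => // i; rewrite !finset.inE => /eqP ->.
  by [].
have := sum_likelihood_ratio_le l0 dl01 (expR_gt0 _)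
  (fun j => measurable_block_lr Z a b (block j))
  (fun j w => block_lr_ge0 Z a (block j) w b0) EL ELdl indepL mD.
rewrite -rhoE => H.
have N0 : 0 < l%:R :> R by rewrite ltr0n.
rewrite -(@lee_pmul2l _ l%:R%:E)//.
rewrite type1E; apply: le_trans H.
have -> : l%:R%:E = (\sum_(j < l) 1%:E)%E :> \bar R.
  by rewrite sumEFin sumr_const card_ord.
rewrite ge0_sume_distrl; last by move=> j _; rewrite lee_fin.
by apply: lee_sum => j _; rewrite mul1e; exact: power_le.
Qed.

End finite_sample_bound.

(** * From the finite sample bound to undetectability *)

Lemma limn_esup_le_near (R : realType) (u w : (\bar R)^nat) (alpha : R) :
  (forall e : R, 0 < e -> \forall n \near \oo, (w n <= u n + e%:E)%E) ->
  (limn_esup u <= alpha%:E)%E -> (limn_esup w <= alpha%:E)%E.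
Proof.
move=> wu ua; apply/lee_addgt0Pr => e e0.
have e2 : 0 < e / 2 by rewrite divr_gt0.
have /ereal_inf_lt[_ [V oV <-] Va] : (limn_esup u < alpha%:E + (e / 2)%:E)%E.
  by apply: (le_lt_trans ua); rewrite -EFinD lte_fin ltrDl.
have oW : \oo (V `&` [set n | (w n <= u n + (e / 2)%:E)%E]).
  by apply: filterI => //; exact: wu.
set W := _ `&` _ in oW.
apply: (@le_trans _ _ (ereal_sup [set w n | n in W])).
  by apply: ereal_inf_lbound; exists W.
apply: ge_ereal_sup => _ [n [Vn /= wn] <-].
apply: (le_trans wn); rewrite [e in leRHS]splitr EFinD addeA; apply: leeD2r.
by apply: ltW; apply: le_lt_trans Va; apply: ereal_sup_ubound; exists n.
Qed.

(** In the variable [z = 1 + x] the difference of the two sides has derivative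
    [(z - 1) ^ 2 / z].  The coefficient 1/2 is the one that enters the constant
    of the small variance regime. *)
Lemma ln1D_ge (R : realType) (x : R) : 0 <= x -> x - x ^+ 2 / 2 <= ln (1 + x).
Proof.
move=> x0.
pose f : R -> R := (@ln R) + 2^-1 \*: (id ^+ 2) - 2 \*: id.
pose g (z : R) := (z - 1) ^+ 2 / z.
have df (z : R) : 0 < z -> is_derive z 1 f (g z).
  move=> z0; have dl := is_derive1_ln z0.
  rewrite /f; apply: is_derive_eq.
  rewrite /g /GRing.scale/=; field; exact: lt0r_neq0.
have x1 : 1 <= 1 + x by rewrite lerDl.
have [| |c cx fE] := @MVT_segment R f g 1 (1 + x) x1.
- move=> z; rewrite in_itv/= => /andP[z1 _]; apply: df.
  exact: lt_trans z1.
- apply: derivable_within_continuous => z; rewrite in_itv/= => /andP[z1 _].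
  by apply: ex_derive; apply: df; exact: lt_le_trans z1.
have : 0 <= f (1 + x) - f 1.
  rewrite fE mulr_ge0//; last by rewrite subr_ge0.
  rewrite divr_ge0 ?sqr_ge0//.
  by move: cx; rewrite in_itv/= => /andP[c1 _]; exact: le_trans c1.
have fz z : f z = ln z + 2^-1 * z ^+ 2 - 2 * z by [].
rewrite !fz ln1; lra.
Qed.

Section undetectability.
Context (R : realType) (d : nat -> measure_display)
  (T : forall n, measurableType (d n)) (P : forall n, probability (T n) R)
  (Z : forall n, 'I_n -> {RV (P n) >-> R}).
Hypothesis HZ : forall n, iid_std_normal (@Z n).
Variables (s0 : R) (Delta s h : R^nat).
Hypotheses (Hs0 : 0 < s0)
  (Hh : forall n, (0 < n)%N -> 0 < h n <= 1)
  (Hl : forall n, (0 < n)%N -> (h n)^-1 \is a Num.nat)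
  (Hnh : forall n, (0 < n)%N -> n%:R * h n \is a Num.nat).

Let a n := Delta n / s0.
Let v n := (s n / s0) ^+ 2.

Lemma undetectable_of_exponent (dl : R^nat) :
  (\forall n \near \oo, 0 <= dl n <= 1) ->
  (\forall n \near \oo, dl n * v n <= 2^-1) ->
  (forall B, \forall n \near \oo, n%:R * h n *
      (dl n * bump_kl (a n) (v n) +
       dl n ^+ 2 * (v n ^+ 2 + a n ^+ 2 * (1 + v n))) +
      dl n * ln (h n) <= B) ->
  undetectable Z s0 Delta s h.
Proof.
move=> dl01 dlv toNy alpha Phi _; apply: limn_esup_le_near => e e0.
pose B := Num.min 0 (2 * ln (e / 2)).
near=> n.
have n0 : (0 < n)%N by near: n; exact: nbhs_infty_gt.
have /andP[h0 _] := Hh n0.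
have dl01n : 0 <= dl n <= 1 by near: n.
have dlvn : dl n * v n <= 2^-1 by near: n.
apply: (le_trans (power_le_type1_error (HZ n) (Phi n) Hs0 n0 h0 (Hl n0)
  (Hnh n0) dl01n dlvn erefl)).
apply: leeD2l; rewrite lee_fin -/(a n) -/(v n).
set E := (X in expR X).
have : E <= B by rewrite /E; near: n; exact: toNy.
rewrite le_min => /andP[E0 Ee].
have sE : Num.sqrt (expR E) = expR (2^-1 * E).
  by rewrite sqrtr_expR_ln ?expR_gt0// expRK.
have e2 : 0 < e / 2 by rewrite divr_gt0.
have h1 : expR (2^-1 * E) <= e / 2.
  by rewrite -[leRHS]lnK ?posrE// ler_expR; lra.
have h2 : expR E <= expR (2^-1 * E) by rewrite ler_expR; lra.
rewrite sE; lra.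
Unshelve. all: by end_near. Qed.

Variable eps : R^nat.
Hypotheses (eps_to0 : eps @ \oo --> 0)
  (eps_log : (fun n => eps n * Num.sqrt (- ln (h n))) @ \oo --> +oo).

Lemma eps_log_ge (B : R) :
  \forall n \near \oo, B <= eps n * Num.sqrt (- ln (h n)).
Proof. by move: B; apply/cvgryPge. Qed.

Lemma near_eps_gt0 : \forall n \near \oo, 0 < eps n.
Proof.
have := eps_log_ge 1; apply: filterS => n H.
rewrite ltNge; apply/negP => en.
have : eps n * Num.sqrt (- ln (h n)) <= 0 by rewrite mulr_le0_ge0.
by move=> /(le_trans H); rewrite ler10.
Qed.

Lemma near_eps_le (e : R) : 0 < e -> \forall n \near \oo, eps n <= e.
Proof.
move=> e0; have /cvgr0Pnorm_le/(_ e e0) := eps_to0.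
by apply: filterS => n; exact/le_trans/ler_norm.
Qed.

Lemma near_littleo (r : R^nat) (e : R) : r =o_\oo eps -> 0 < e ->
  \forall n \near \oo, `|r n| <= e * eps n.
Proof.
move=> /eqoP/(_ e) H e0; near=> n.
have en : 0 < eps n by near: n; exact: near_eps_gt0.
by rewrite -[X in e * X]gtr0_norm//; near: n; exact: H.
Unshelve. all: by end_near. Qed.

(** With [dl = eta * eps] the exponent is at most
    [- eta * eps * (c1 * eps - eta * K * eps) * ln (1 / h)]; for
    [eta = c1 / (2 * K)] this is [- (eta * c1 / 2) * (eps ^ 2 * ln (1 / h))]. *)
Lemma undetectable_of_rate (c1 K V : R) : 0 < c1 -> 0 < K -> 0 < V ->
  (\forall n \near \oo, v n <= V) ->
  (\forall n \near \oo, n%:R * h n * bump_kl (a n) (v n) <=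
                        (1 - c1 * eps n) * - ln (h n)) ->
  (\forall n \near \oo, n%:R * h n * (v n ^+ 2 + a n ^+ 2 * (1 + v n)) <=
                        K * - ln (h n)) ->
  undetectable Z s0 Delta s h.
Proof.
move=> c10 K0 V0 vV klE remE.
pose eta := c1 / (2 * K).
have eta0 : 0 < eta by rewrite divr_gt0// mulr_gt0.
have v0 n : 0 <= v n by exact: sqr_ge0.
apply: (@undetectable_of_exponent (fun n => eta * eps n)).
- near=> n; apply/andP; split.
    by rewrite mulr_ge0 ?(ltW eta0)// ltW//; near: n; exact: near_eps_gt0.
  rewrite mulrC -ler_pdivlMr// mul1r; near: n; apply: near_eps_le.
  by rewrite invr_gt0.
- near=> n.
  have en : eps n <= (2 * eta * V)^-1.
    by near: n; apply: near_eps_le; rewrite invr_gt0 mulr_gt0// mulr_gt0.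
  apply: (@le_trans _ _ (eta * (2 * eta * V)^-1 * V)).
    have e0 : 0 <= eps n by apply: ltW; near: n; exact: near_eps_gt0.
    apply: ler_pM => //; first by rewrite mulr_ge0// ltW.
      by rewrite ler_wpM2l// ltW.
    by near: n.
  by rewrite le_eqVlt; apply/orP; left; apply/eqP; field; rewrite !gt_eqF.
- move=> B.
  pose k := eta * c1 / 2.
  have k0 : 0 < k by rewrite divr_gt0// mulr_gt0.
  pose X := 1 + `|B| / k.
  near=> n.
  have en : 0 < eps n by near: n; exact: near_eps_gt0.
  have XE : X <= eps n * Num.sqrt (- ln (h n)) by near: n; exact: eps_log_ge.
  have n0 : (0 < n)%N by near: n; exact: nbhs_infty_gt.
  have W0 : 0 <= - ln (h n) by have /andP[? ?] := Hh n0; rewrite oppr_ge0 ln_le0.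
  have X1 : 1 <= X by rewrite lerDl divr_ge0// ltW.
  have X2 : X <= eps n ^+ 2 * - ln (h n).
    rewrite -[- ln _]sqr_sqrtr// -exprMn.
    apply: (@le_trans _ _ (X ^+ 2)); first exact: ler_eXnr.
    have X0 : 0 <= X by exact: le_trans X1.
    by rewrite ler_sqr ?nnegrE// (le_trans X0).
  have H1 : n%:R * h n * bump_kl (a n) (v n) <= (1 - c1 * eps n) * - ln (h n).
    by near: n.
  have H2 : n%:R * h n * (v n ^+ 2 + a n ^+ 2 * (1 + v n)) <= K * - ln (h n).
    by near: n.
  set W := - ln (h n) in H1 H2 X2 W0 *.
  have -> : ln (h n) = - W by rewrite opprK.
  apply: (@le_trans _ _ (- (k * (eps n ^+ 2 * W)))).
    have -> : n%:R * h n * (eta * eps n * bump_kl (a n) (v n) +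
        (eta * eps n) ^+ 2 * (v n ^+ 2 + a n ^+ 2 * (1 + v n))) +
        eta * eps n * - W =
      eta * eps n * (n%:R * h n * bump_kl (a n) (v n)) +
      (eta * eps n) ^+ 2 * (n%:R * h n * (v n ^+ 2 + a n ^+ 2 * (1 + v n))) -
      eta * eps n * W by ring.
    have -> : - (k * (eps n ^+ 2 * W)) =
      eta * eps n * ((1 - c1 * eps n) * W) + (eta * eps n) ^+ 2 * (K * W) -
      eta * eps n * W.
      by rewrite /k /eta; field; rewrite gt_eqF.
    rewrite lerD2r lerD// ler_wpM2l ?sqr_ge0// mulr_ge0// ltW//.
  rewrite lerNl; apply: (@le_trans _ _ (k * X)).
    rewrite /X mulrDr mulr1 mulrCA divff ?gt_eqF// mulr1.
    have := ler_norm (- B); rewrite normrN; lra.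
  by rewrite ler_wpM2l// ltW.
Unshelve. all: by end_near. Qed.

End undetectability.

(** * The two regimes *)

(** Since [(1 - z) ^ 2 <= 1 - z] for [z = x / C], the square gains [z]; half of
    this gain pays for the relative error [y]. *)
Lemma squared_signal_bound (R : realType) (C x : R) : 0 < C -> 0 <= x <= C ->
  forall y, 0 <= y <= x / (2 * C) ->
  ((C - x) / C) ^+ 2 * (1 + y) <= 1 - (2 * C)^-1 * x.
Proof.
move=> C0 /andP[x0 xC] y /andP[y0 yx].
have -> : (C - x) / C = 1 - x / C by field; rewrite gt_eqF.
have -> : (2 * C)^-1 * x = (x / C) / 2 by field; rewrite gt_eqF.
have {}yx : y <= x / C / 2.
  by rewrite (le_trans yx)// le_eqVlt; apply/orP; left; apply/eqP; field; rewrite gt_eqF.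
have z0 : 0 <= x / C by rewrite divr_ge0// ltW.
have z1 : x / C <= 1 by rewrite ler_pdivrMr// mul1r.
move: (x / C) z0 z1 yx => z z0 z1 yx; nra.
Qed.


Lemma one_plus_le2 (R : realType) (x : R) : `|x| <= 1 -> 1 + x <= 2.
Proof. by move=> /(le_trans (ler_norm x)); lra. Qed.

Section rates.
Context (R : realType).
Implicit Types c k q r x W : R.

(** Here [v = c * A * (1 + r)] and
    [bump_kl A v <= (A ^ 2 + v ^ 2 / 2) / 2], which for [r = 0] equals
    [(s0 * A / C) ^ 2].  The bound on [r] gives [(1 + r) ^ 2 <= 1 + x / (2 * C)],
    a relative error that [squared_signal_bound] allows. *)
Lemma small_variance_rate s0 c q A r x W :
  let C := Num.sqrt 2 * s0 * Num.sqrt (2 / (2 + c ^+ 2)) in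
  0 < s0 -> 0 < c -> 0 <= q -> 0 < A -> 0 <= W -> 0 <= x <= C ->
  `|r| <= (6 * C)^-1 * x ->
  Num.sqrt q * (s0 * A) <= (C - x) * Num.sqrt W ->
  q * bump_kl A (c * A * (1 + r)) <= (1 - (2 * C)^-1 * x) * W /\
  q * A ^+ 2 <= C ^+ 2 / s0 ^+ 2 * W.
Proof.
move=> C s00 c0 q0 A0 W0 /andP[x0 xC] rx H.
have c2 : 0 < 2 + c ^+ 2 by rewrite ltr_pwDl// sqr_ge0.
have C0 : 0 < C by rewrite !mulr_gt0// sqrtr_gt0// divr_gt0.
have C2 : C ^+ 2 = 4 * s0 ^+ 2 / (2 + c ^+ 2).
  rewrite /C !exprMn !sqr_sqrtr//; last by rewrite ltW// divr_gt0.
  by field; rewrite gt_eqF.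
clearbody C.
have {}H : q * (s0 * A) ^+ 2 <= (C - x) ^+ 2 * W.
  have : (Num.sqrt q * (s0 * A)) ^+ 2 <= ((C - x) * Num.sqrt W) ^+ 2.
    by rewrite ler_sqr// nnegrE mulr_ge0// ?subr_ge0// mulr_ge0// ltW.
  by rewrite exprMn sqr_sqrtr// [leRHS]exprMn sqr_sqrtr.
have s2 : 0 < s0 ^+ 2 by rewrite exprn_gt0.
split; last first.
  have -> : q * A ^+ 2 = q * (s0 * A) ^+ 2 / s0 ^+ 2 by field; rewrite gt_eqF.
  rewrite [leRHS]mulrAC ler_pM2r ?invr_gt0//.
  apply: (le_trans H); rewrite ler_wpM2r// ler_sqr ?nnegrE ?subr_ge0 ?(ltW C0)//.
  by rewrite gerBl.
pose y := x / (2 * C).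
have rxy : 3 * `|r| <= y.
  have -> : y = 3 * ((6 * C)^-1 * x) by rewrite /y; field; rewrite gt_eqF.
  by rewrite ler_pM2l.
have y0 : 0 <= y by rewrite divr_ge0// mulr_ge0// ltW.
have y1 : y <= 2^-1.
  by rewrite /y ler_pdivrMr ?mulr_gt0//; lra.
have [r1 r2] : - `|r| <= r /\ r <= `|r|.
  by split; [rewrite lerNl -normrN ler_norm|exact: ler_norm].
have r1y : (1 + r) ^+ 2 <= 1 + y by move: (normr_ge0 r) => ?; nra.
set V := c * A * (1 + r).
have V0 : 0 <= V by rewrite !mulr_ge0 ?(ltW c0) ?(ltW A0)//; lra.
have kl : bump_kl A V <= (s0 * A) ^+ 2 / C ^+ 2 * (1 + y).
  have := ln1D_ge V0; rewrite /bump_kl => lnV.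
  apply: (@le_trans _ _ ((V ^+ 2 / 2 + A ^+ 2) / 2)); first by lra.
  have -> : V ^+ 2 = c ^+ 2 * A ^+ 2 * (1 + r) ^+ 2 by rewrite /V; ring.
  have -> : (s0 * A) ^+ 2 / C ^+ 2 * (1 + y) =
      (c ^+ 2 * A ^+ 2 * (1 + y) / 2 + A ^+ 2 * (1 + y)) / 2.
    by rewrite C2; field; rewrite !gt_eqF.
  have : c ^+ 2 * A ^+ 2 * (1 + r) ^+ 2 <= c ^+ 2 * A ^+ 2 * (1 + y).
    by rewrite ler_wpM2l// mulr_ge0 ?sqr_ge0.
  have : 0 <= A ^+ 2 * y by rewrite mulr_ge0 ?sqr_ge0.
  lra.
apply: (le_trans (ler_wpM2l q0 kl)).
have -> : q * ((s0 * A) ^+ 2 / C ^+ 2 * (1 + y)) =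
  (q * (s0 * A) ^+ 2) * ((1 + y) / C ^+ 2) by field; rewrite gt_eqF.
have y3 : 0 <= (1 + y) / C ^+ 2 by rewrite divr_ge0 ?sqr_ge0// addr_ge0.
apply: (le_trans (ler_wpM2r y3 H)).
have -> : (C - x) ^+ 2 * W * ((1 + y) / C ^+ 2) =
  ((C - x) / C) ^+ 2 * (1 + y) * W by field; rewrite gt_eqF.
rewrite ler_wpM2r// squared_signal_bound//; first by rewrite x0.
by rewrite y0 lexx.
Qed.

(** For [r = r' = 0] the divergence is [C ^ -2].  The derivatives of [bump_kl]
    are bounded near this point, so that relative errors of size [tau * x] add at most
    [(k ^ 2 + 3 / 2 * (k ^ 2 / c) ^ 2) * tau * x], and [tau] makes this
    [C ^ -2 * (x / (2 * C))]. *)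
Lemma fixed_variance_rate k c q r r' x W :
  let C := 1 / Num.sqrt (k ^+ 2 / (2 * c ^+ 2) * (k ^+ 2 + c ^+ 2)
                         - 1 / 2 * ln (1 + k ^+ 2)) in
  let tau := (2 * (k ^+ 2 + 3 / 2 * (k ^+ 2 / c) ^+ 2) * C ^+ 3)^-1 in
  0 < k -> 0 < c -> 0 <= q -> 0 <= W -> 0 <= x <= C ->
  `|r| <= 1 -> `|r'| <= 1 -> `|r| <= tau * x -> `|r'| <= tau * x ->
  Num.sqrt q <= (C - x) * Num.sqrt W ->
  q * bump_kl (k ^+ 2 / c * (1 + r')) (k ^+ 2 * (1 + r)) <=
  (1 - (2 * C)^-1 * x) * W /\ q <= C ^+ 2 * W.
Proof.
move=> C tau k00 c0 q0 W0 /andP[x0 xC] r1 r'1 rx r'x H.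
have k2 : 0 < k ^+ 2 by rewrite exprn_gt0.
set u := k ^+ 2 in k2 C tau x0 xC rx r'x H *.
set m := u / c in tau rx r'x *.
have m0 : 0 < m by rewrite divr_gt0.
pose k0 := bump_kl m u.
have k0E : k0 = u / (2 * c ^+ 2) * (u + c ^+ 2) - 1 / 2 * ln (1 + u).
  by rewrite /k0 /bump_kl /m; field; rewrite gt_eqF.
have k0_gt0 : 0 < k0.
  have : ln (1 + u) <= u by apply: le_ln1Dx; lra.
  have : 0 < m ^+ 2 by rewrite exprn_gt0.
  by rewrite /k0 /bump_kl => ? ?; rewrite divr_gt0//; lra.
have C0 : 0 < C by rewrite /C -k0E divr_gt0// sqrtr_gt0.
have C2 : C ^+ 2 = k0^-1 by rewrite /C -k0E div1r exprVn sqr_sqrtr// ltW.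
clearbody C.
have {}H : q <= (C - x) ^+ 2 * W.
  have : Num.sqrt q ^+ 2 <= ((C - x) * Num.sqrt W) ^+ 2.
    by rewrite ler_sqr// nnegrE// mulr_ge0// subr_ge0.
  by rewrite exprMn !sqr_sqrtr.
split; last first.
  apply: (le_trans H); rewrite ler_wpM2r// ler_sqr ?nnegrE ?subr_ge0 ?(ltW C0)//.
  by rewrite gerBl.
pose B := u + 3 / 2 * m ^+ 2.
have B0 : 0 < B by rewrite addr_gt0// mulr_gt0// ?exprn_gt0// divr_gt0.
pose y := x / (2 * C).
have tauE : B * (tau * x) = k0 * y.
  rewrite /tau -/B -[k0]invrK -C2 /y; field; rewrite !gt_eqF//.
have y0 : 0 <= y by rewrite divr_ge0// mulr_ge0// ltW.
have kl : bump_kl (m * (1 + r')) (u * (1 + r)) <= k0 * (1 + y).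
  have -> : k0 * (1 + y) = k0 + B * (tau * x) by rewrite tauE; ring.
  rewrite /k0 /bump_kl.
  have [? ?] : - `|r| <= r /\ r <= `|r|.
    by split; [rewrite lerNl -normrN ler_norm|exact: ler_norm].
  have [? ?] : - `|r'| <= r' /\ r' <= `|r'|.
    by split; [rewrite lerNl -normrN ler_norm|exact: ler_norm].
  set t := tau * x in rx r'x *.
  have lnD : ln (1 + u) - ln (1 + u * (1 + r)) <= u * t.
    have p1 : 0 < 1 + u by lra.
    have p3 : 0 <= u * (1 + r) by rewrite mulr_ge0 ?(ltW k2)//; lra.
    have p2 : 0 < 1 + u * (1 + r) by lra.
    rewrite -ln_div ?posrE//.
    have -> : (1 + u) / (1 + u * (1 + r)) = 1 + (- (u * r)) / (1 + u * (1 + r)).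
      by field; rewrite gt_eqF.
    apply: (le_trans (le_ln1Dx _)).
      rewrite ltr_pdivlMr//; lra.
    rewrite ler_pdivrMr//.
    apply: (@le_trans _ _ (u * t)).
      by rewrite -mulrN ler_wpM2l ?(ltW k2)//; lra.
    rewrite ler_peMr//; last by lra.
    by rewrite mulr_ge0 ?(ltW k2)//; lra.
  have mD : (m * (1 + r')) ^+ 2 <= m ^+ 2 + 3 * m ^+ 2 * t.
    have -> : m ^+ 2 + 3 * m ^+ 2 * t = m ^+ 2 * (1 + 3 * t) by ring.
    by rewrite exprMn ler_wpM2l ?sqr_ge0//; nra.
  have uD : u * (1 + r) <= u + u * t.
    by rewrite mulrDr mulr1 lerD2l ler_wpM2l ?(ltW k2)//; lra.
  rewrite /B; lra.
apply: (le_trans (ler_wpM2l q0 kl)).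
have k0y : 0 <= k0 * (1 + y) by rewrite mulr_ge0 ?(ltW k0_gt0)// addr_ge0.
apply: (le_trans (ler_wpM2r k0y H)).
have -> : (C - x) ^+ 2 * W * (k0 * (1 + y)) =
  ((C - x) / C) ^+ 2 * (1 + y) * W.
  by rewrite -[k0]invrK -C2; field; rewrite gt_eqF.
rewrite ler_wpM2r// squared_signal_bound//; first by rewrite x0.
by rewrite y0 lexx.
Qed.

End rates.

Theorem theorem4p2 (R : realType) (d : nat -> measure_display)
  (T : forall n, measurableType (d n)) (P : forall n, probability (T n) R)
  (Z : forall n, 'I_n -> {RV (P n) >-> R})
  (HZ : forall n, iid_std_normal (Z n))
  (s0 : R) (Hs0 : 0 < s0)
  (Delta s h : R^nat)
  (HDelta : forall n, (0 < n)%N -> 0 < Delta n)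
  (Hs : forall n, (0 < n)%N -> 0 < s n)
  (Hh : forall n, (0 < n)%N -> 0 < h n <= 1)
  (Hl : forall n, (0 < n)%N -> (h n)^-1 \is a Num.nat)
  (Hnh : forall n, (0 < n)%N -> n%:R * h n \is a Num.nat)
  (h_to0 : h @ \oo --> 0)
  (eps : R^nat) (eps_to0 : eps @ \oo --> 0)
  (eps_log : (fun n => eps n * Num.sqrt (- ln (h n))) @ \oo --> +oo) :
  (forall c : R, 0 < c ->
    let C := Num.sqrt 2 * s0 * Num.sqrt (2 / (2 + c ^+ 2)) in
    eq_up_to_littleo (fun n => s n ^+ 2) (fun n => c * s0 * Delta n) eps ->
    (fun n => s n ^+ 2) =o_\oo eps ->
    (\forall n \near \oo,
      Num.sqrt (n%:R * h n) * Delta n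
        <= (C - eps n) * Num.sqrt (- ln (h n))) ->
    undetectable Z s0 Delta s h)
  /\
  (forall sigma c : R, 0 < sigma -> 0 < c ->
    let kappa := sigma / s0 in
    let C := 1 / Num.sqrt (kappa ^+ 2 / (2 * c ^+ 2) * (kappa ^+ 2 + c ^+ 2)
                           - 1 / 2 * ln (1 + kappa ^+ 2)) in
    eq_up_to_littleo (fun n => s n ^+ 2) (fun=> sigma ^+ 2) eps ->
    eq_up_to_littleo Delta (fun=> sigma ^+ 2 / (c * s0)) eps ->
    (\forall n \near \oo,
      Num.sqrt (n%:R * h n) <= (C - eps n) * Num.sqrt (- ln (h n))) ->
    undetectable Z s0 Delta s h).
Proof.
have near_pos : \forall n \near \oo, (0 < n)%N by exact: nbhs_infty_gt.
have W0 n : (0 < n)%N -> 0 <= - ln (h n).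
  by move=> /Hh/andP[_ h1]; rewrite oppr_ge0 ln_le0.
have q0 n : (0 < n)%N -> 0 <= n%:R * h n.
  by move=> /Hh/andP[h1 _]; rewrite mulr_ge0// ltW.
have vE n : (s n / s0) ^+ 2 = s n ^+ 2 / s0 ^+ 2 by rewrite expr_div_n.
have eps_gt0 := near_eps_gt0 eps_log.
split.
- move=> c c0 C [r ro sE] so main.
  have C0 : 0 < C.
    by rewrite !mulr_gt0// sqrtr_gt0// divr_gt0// ltr_pwDl// sqr_ge0.
  (* [v <= 2 * c * a] and [v <= 1] bound the second order term by
     [(4 * c ^ 2 + 2) * a ^ 2]. *)
  pose K := (4 * c ^+ 2 + 2) * (C ^+ 2 / s0 ^+ 2).
  have K0 : 0 < K.
    by rewrite mulr_gt0 ?divr_gt0 ?exprn_gt0// ltr_wpDl// mulr_ge0 ?sqr_ge0.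
  have tau0 : 0 < (6 * C)^-1 by rewrite invr_gt0 mulr_gt0.
  have near_r := near_littleo eps_log ro tau0.
  have near_s := near_littleo eps_log so (exprn_gt0 2 Hs0).
  have c10 : 0 < (2 * C)^-1 by rewrite invr_gt0 mulr_gt0.
  have near_V : \forall n \near \oo, (s n / s0) ^+ 2 <= 1.
    near=> n.
    have en : 0 < eps n by near: n.
    have e1 : eps n <= 1 by near: n; exact: near_eps_le.
    have : `|s n ^+ 2| <= s0 ^+ 2 * eps n by near: n.
    rewrite ger0_norm ?sqr_ge0// vE ler_pdivrMr ?exprn_gt0// mul1r => /le_trans.
    by apply; rewrite ler_piMr// sqr_ge0.
  pose rate n := [/\ (s n / s0) ^+ 2 = c * (Delta n / s0) * (1 + r n),
      `|r n| <= 1,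
      n%:R * h n * bump_kl (Delta n / s0) (c * (Delta n / s0) * (1 + r n)) <=
        (1 - (2 * C)^-1 * eps n) * - ln (h n) &
      n%:R * h n * (Delta n / s0) ^+ 2 <= C ^+ 2 / s0 ^+ 2 * - ln (h n)].
  have near_rate : \forall n \near \oo, rate n.
    near=> n.
    have n0 : (0 < n)%N by near: n.
    have en : 0 < eps n by near: n.
    have eC : eps n <= C by near: n; exact: near_eps_le.
    have rn : `|r n| <= (6 * C)^-1 * eps n by near: n.
    suff [] : n%:R * h n * bump_kl (Delta n / s0) (c * (Delta n / s0) * (1 + r n))
        <= (1 - (2 * C)^-1 * eps n) * - ln (h n) /\
        n%:R * h n * (Delta n / s0) ^+ 2 <= C ^+ 2 / s0 ^+ 2 * - ln (h n).
      move=> kl signal; split=> //.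
        rewrite vE (_ : s n ^+ 2 = c * s0 * Delta n * (1 + r n)); last by near: n.
        by field; rewrite gt_eqF.
      have C6 : 0 < 6 * C by rewrite -invr_gt0.
      apply: (le_trans rn); rewrite ler_pdivrMl// mulr1.
      by rewrite (le_trans eC)// ler_peMl ?(ltW C0)// ler1n.
    apply: small_variance_rate => //.
    + exact: q0.
    + by rewrite divr_gt0// HDelta.
    + exact: W0.
    + by rewrite ltW.
    + have -> : s0 * (Delta n / s0) = Delta n by field; rewrite gt_eqF.
      by near: n.
  apply: (undetectable_of_rate HZ Hs0 Hh Hl Hnh eps_to0 eps_log c10 K0 ltr01).
  + exact: near_V.
  + by apply: filterS near_rate => n [-> _].
  + near=> n.
    have n0 : (0 < n)%N by near: n.
    have v1 : (s n / s0) ^+ 2 <= 1 by near: n.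
    have [vn r1 _ aE] : rate n by near: n.
    have a0 : 0 < Delta n / s0 by rewrite divr_gt0// HDelta.
    set a := Delta n / s0 in vn aE a0 *; set v := (s n / s0) ^+ 2 in vn v1 *.
    have v0 : 0 <= v by exact: sqr_ge0.
    have va : v <= 2 * (c * a).
      rewrite vn mulrC; apply: ler_wpM2r; last exact: one_plus_le2.
      exact: ltW (mulr_gt0 c0 a0).
    have v2 : v ^+ 2 + a ^+ 2 * (1 + v) <= (4 * c ^+ 2 + 2) * a ^+ 2.
      have : v ^+ 2 <= (2 * (c * a)) ^+ 2.
        by rewrite ler_sqr ?nnegrE// (le_trans v0).
      have : a ^+ 2 * v <= a ^+ 2 by rewrite ler_piMr// sqr_ge0.
      by rewrite !exprMn; lra.
    apply: (le_trans (ler_wpM2l (q0 n n0) v2)).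
    rewrite mulrCA /K -mulrA ler_wpM2l//.
    by rewrite addr_ge0// mulr_ge0 ?sqr_ge0.
- move=> sigma c sigma0 c0 kappa C [r ro sE] [r' ro' DE] main.
  have k0 : 0 < kappa by rewrite divr_gt0.
  have k2 : 0 < kappa ^+ 2 by rewrite exprn_gt0.
  have C0 : 0 < C.
    rewrite /C divr_gt0// sqrtr_gt0.
    have : ln (1 + kappa ^+ 2) <= kappa ^+ 2 by apply: le_ln1Dx; lra.
    have -> : kappa ^+ 2 / (2 * c ^+ 2) * (kappa ^+ 2 + c ^+ 2) =
      kappa ^+ 2 / 2 + (kappa ^+ 2 / c) ^+ 2 / 2 by field; rewrite gt_eqF.
    have : 0 < (kappa ^+ 2 / c) ^+ 2 by rewrite exprn_gt0// divr_gt0.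
    lra.
  pose m := kappa ^+ 2 / c.
  have m0 : 0 < m by rewrite divr_gt0.
  pose tau := (2 * (kappa ^+ 2 + 3 / 2 * m ^+ 2) * C ^+ 3)^-1.
  have tau0 : 0 < tau.
    rewrite invr_gt0 mulr_gt0 ?exprn_gt0// mulr_gt0// addr_gt0//.
    by rewrite mulr_gt0 ?exprn_gt0// divr_gt0.
  have near_r := near_littleo eps_log ro tau0.
  have near_r' := near_littleo eps_log ro' tau0.
  have c10 : 0 < (2 * C)^-1 by rewrite invr_gt0 mulr_gt0.
  pose V := 2 * kappa ^+ 2.
  have V0 : 0 < V by rewrite mulr_gt0.
  pose K := C ^+ 2 * (V ^+ 2 + (2 * m) ^+ 2 * (1 + V)).
  have K0 : 0 < K.
    rewrite mulr_gt0 ?exprn_gt0// addr_gt0 ?exprn_gt0// mulr_gt0//.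
      by rewrite exprn_gt0// mulr_gt0.
    by rewrite addr_gt0.
  pose rate n :=
      [/\ (s n / s0) ^+ 2 = kappa ^+ 2 * (1 + r n),
          Delta n / s0 = m * (1 + r' n), `|r n| <= 1, `|r' n| <= 1 &
      n%:R * h n * bump_kl (m * (1 + r' n)) (kappa ^+ 2 * (1 + r n)) <=
        (1 - (2 * C)^-1 * eps n) * - ln (h n) /\
      n%:R * h n <= C ^+ 2 * - ln (h n)].
  have near_rate : \forall n \near \oo, rate n.
    near=> n.
    have n0 : (0 < n)%N by near: n.
    have en : 0 < eps n by near: n.
    have eC : eps n <= C by near: n; exact: near_eps_le.
    have et : eps n <= tau^-1.
      by near: n; apply: near_eps_le => //; rewrite invr_gt0.
    have rn : `|r n| <= tau * eps n by near: n.
    have rn' : `|r' n| <= tau * eps n by near: n.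
    have t1 : tau * eps n <= 1 by rewrite -ler_pdivlMl// mulr1.
    split.
    + rewrite vE (_ : s n ^+ 2 = sigma ^+ 2 * (1 + r n)); last by near: n.
      by rewrite /kappa; field; rewrite gt_eqF.
    + rewrite (_ : Delta n = sigma ^+ 2 / (c * s0) * (1 + r' n)); last by near: n.
      by rewrite /m /kappa; field; rewrite !gt_eqF.
    + exact: le_trans t1.
    + exact: le_trans t1.
    + apply: fixed_variance_rate => //.
      * exact: q0.
      * exact: W0.
      * by rewrite ltW.
      * exact: le_trans t1.
      * exact: le_trans t1.
      * by near: n.
  apply: (undetectable_of_rate HZ Hs0 Hh Hl Hnh eps_to0 eps_log c10 K0 V0).
  + apply: filterS near_rate => n [-> _ r1 _ _].
    rewrite /V mulrC; apply: (ler_wpM2r (ltW k2)).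
    exact: one_plus_le2.
  + by apply: filterS near_rate => n [-> -> _ _ []].
  + near=> n.
    have n0 : (0 < n)%N by near: n.
    have [vn an r1 r1' [_ qE]] : rate n by near: n.
    have a0 : 0 < Delta n / s0 by rewrite divr_gt0// HDelta.
    set a := Delta n / s0 in an a0 *; set v := (s n / s0) ^+ 2 in vn *.
    have v0 : 0 <= v by exact: sqr_ge0.
    have vV : v <= V.
      rewrite vn /V mulrC; apply: (ler_wpM2r (ltW k2)).
      exact: one_plus_le2.
    have am : a <= 2 * m.
      rewrite an mulrC; apply: (ler_wpM2r (ltW m0)).
      exact: one_plus_le2.
    have X : v ^+ 2 + a ^+ 2 * (1 + v) <= V ^+ 2 + (2 * m) ^+ 2 * (1 + V).
      apply: lerD; first by rewrite ler_sqr ?nnegrE// (le_trans v0).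
      apply: ler_pM; rewrite ?sqr_ge0 ?addr_ge0// ?lerD2l//.
      by rewrite ler_sqr ?nnegrE ?(ltW a0)// (le_trans (ltW a0)).
    have X0 : 0 <= v ^+ 2 + a ^+ 2 * (1 + v).
      by rewrite addr_ge0 ?sqr_ge0// mulr_ge0 ?sqr_ge0// addr_ge0.
    apply: (le_trans (ler_wpM2l (q0 n n0) X)).
    rewrite /K [leRHS]mulrAC; apply: ler_wpM2r => //.
    exact: le_trans X.
Unshelve. all: by end_near. Qed.
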